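(* Let $\{f_n\}$ be a sequence of integrable functions defined a.e. on $\mathbb{R}$ and assume that a.e. on $\mathbb{R}$: (1) $0\le f_n(x)\le f_{n+1}(x)$ for every $n$; (2) $\lim_{n\to+\infty}f_n(x)=f(x)$. Then $f$ is integrable and $$\lim_{n\to+\infty}\int_{-\infty}^{+\infty}f_n(x)\,dx=\int_{-\infty}^{+\infty}f(x)\,dx ,$$ the integrals being Lebesgue integrals in the sense of Tonelli (defined in the context; values in $[0,+\infty]$ are allowed).
   Context: A multiinterval $\Delta=\{(a_n,b_n)\}$ is a finite or countable sequence of open intervals of $\mathbb{R}$ (not necessarily disjoint); $\mathcal{I}_\Delta=\bigcup_n(a_n,b_n)$ and $L(\Delta)=\sum_n(b_n-a_n)\in(0,+\infty]$. A set $N\subseteq\mathbb{R}$ is a null set if for every $\varepsilon>0$ there is a multiinterval $\Delta$ with $L(\Delta)<\varepsilon$ and $N\subseteq\mathcal{I}_\Delta$. A property holds a.e. if it fails only on a null set. A real function $f$ defined a.e. on an interval $R$ (possibly unbounded) is quasicontinuous on $R$ if for every $\varepsilon>0$ there is a multiinterval $\Delta_\varepsilon$ with $L(\Delta_\varepsilon)<\varepsilon$ such that $f$ is defined on $R\setminus\mathcal{I}_{\Delta_\varepsilon}$ and the restriction $f_{|R\setminus\mathcal{I}_{\Delta_\varepsilon}}$ is continuous. Lebesgue integral (Tonelli), bounded case: let $f$ be bounded quasicontinuous on the bounded closed interval $R=[h,k]$. Choose for each $n$ a multiinterval $\Delta_n$ with $L(\Delta_n)<1/n$ such that $f_{|R\setminus\mathcal{I}_{\Delta_n}}$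 is continuous, and let $\phi_n$ be a continuous extension of $f_{|R\setminus\mathcal{I}_{\Delta_n}}$ to $R$ having the same infimum and supremum as $f_{|R\setminus\mathcal{I}_{\Delta_n}}$. Then $\int_h^k f:=\lim_n\int_h^k\phi_n$ (Riemann integrals on the right; the limit exists and does not depend on the choices). General case: for $f$ quasicontinuous on $\mathbb{R}$ put $f_+=\max\{f,0\}$, $f_-=\min\{f,0\}$ and $\int_{\mathbb{R}}f_+:=\lim_{\rho\to+\infty,\,N\to+\infty}\int_{-\rho}^{\rho}\min\{f_+(x),N\}\,dx\in[0,+\infty]$, $\int_{\mathbb{R}}f_-:=\lim_{\rho\to+\infty,\,K\to+\infty}\int_{-\rho}^{\rho}\max\{f_-(x),-K\}\,dx\in[-\infty,0]$. The quasicontinuous function $f$ is integrable if at least one of these two is finite, and then $\int_{\mathbb{R}}f:=\int_{\mathbb{R}}f_++\int_{\mathbb{R}}f_-$; it is summable if this integral is finite. *)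

(* Defs.v *)
(* Stdlib reals with Coquelicot. *)
From Stdlib Require Import Reals ClassicalEpsilon.
From Coquelicot Require Import Coquelicot.
Open Scope R_scope.

(* Degenerate terms [lft n = rgt n] are empty intervals of length 0: they encode
   finite sequences.  At least one interval is nonempty, so that the total length
   lies in (0, +oo]. *)
Record multiinterval := MultiInterval {
  lft : nat -> R;
  rgt : nat -> R;
  lft_le_rgt : forall n, lft n <= rgt n;
  multiinterval_nonempty : exists n, lft n < rgt n
}.

Definition mcover (D : multiinterval) (x : R) : Prop :=
  exists n, lft D n < x < rgt D n.

Definition mlength (D : multiinterval) : Rbar :=
  Lim_seq (sum_n (fun n => rgt D n - lft D n)).

Definition null_set (N : R -> Prop) : Prop :=
  forall eps : posreal, exists D : multiinterval,
    Rbar_lt (mlength D) eps /\ forall x, N x -> mcover D x.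

Definition ae (P : R -> Prop) : Prop := null_set (fun x => ~ P x).

(* A partial real function; the values of [val] outside [dom] are junk, and
   nothing below depends on them. *)
Record pfun := PFun { dom : R -> Prop; val :> R -> R }.

Definition defined_ae_on (S : R -> Prop) (f : pfun) : Prop :=
  null_set (fun x => S x /\ ~ dom f x).

Definition restr_continuous (S : R -> Prop) (f : pfun) : Prop :=
  (forall x, S x -> dom f x) /\ continuous_on S f.

Definition outside (S : R -> Prop) (D : multiinterval) (x : R) : Prop :=
  S x /\ ~ mcover D x.

Definition quasicontinuous_on (S : R -> Prop) (f : pfun) : Prop :=
  defined_ae_on S f /\
  forall eps : posreal, exists D : multiinterval,
    Rbar_lt (mlength D) eps /\ restr_continuous (outside S D) f.

Definition line (x : R) : Prop := True.
Definition segment (h k x : R) : Prop := h <= x <= k.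

Definition bounded_on (S : R -> Prop) (f : pfun) : Prop :=
  exists M, forall x, S x -> dom f x -> Rabs (f x) <= M.

Definition image (f : R -> R) (S : R -> Prop) (y : R) : Prop :=
  exists x, S x /\ y = f x.

(* The sequences (phi_n) of continuous functions that may be used to compute the
   integral of [f] over [h, k]; the index is shifted so that 1/n makes sense. *)
Definition approximating (f : pfun) (h k : R) (phi : nat -> R -> R) : Prop :=
  exists D : nat -> multiinterval, forall n,
    let S := outside (segment h k) (D n) in
    Rbar_lt (mlength (D n)) (/ INR (n + 1)) /\
    restr_continuous S f /\
    continuous_on (segment h k) (phi n) /\
    (forall x, S x -> phi n x = f x) /\
    Glb_Rbar (image (phi n) (segment h k)) = Glb_Rbar (image f S) /\
    Lub_Rbar (image (phi n) (segment h k)) = Lub_Rbar (image f S).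

Definition is_bounded_integral (f : pfun) (h k v : R) : Prop :=
  bounded_on (segment h k) f /\
  quasicontinuous_on (segment h k) f /\
  exists phi, approximating f h k phi /\
    is_lim_seq (fun n => RInt (phi n) h k) v.

(* [iota P] is the unique real satisfying [P], if there is one. *)
Definition bounded_integral (f : pfun) (h k : R) : R :=
  iota (is_bounded_integral f h k).

Definition pmap (g : R -> R) (f : pfun) : pfun := PFun (dom f) (fun x => g (f x)).

Definition pos_part (f : pfun) : pfun := pmap (fun y => Rmax y 0) f.
(* Nonpositive, with f = f_+ + f_-. *)
Definition neg_part (f : pfun) : pfun := pmap (fun y => Rmin y 0) f.

Definition is_lim2 (F : R -> R -> R) (l : Rbar) : Prop :=
  filterlim (fun p : R * R => F (fst p) (snd p))
    (filter_prod (Rbar_locally p_infty) (Rbar_locally p_infty))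
    (Rbar_locally l).

Definition lim2 (F : R -> R -> R) : Rbar :=
  epsilon (inhabits (Finite 0)) (is_lim2 F).

Definition integral_pos (f : pfun) : Rbar :=
  lim2 (fun rho N =>
    bounded_integral (pmap (fun y => Rmin y N) (pos_part f)) (- rho) rho).

Definition integral_neg (f : pfun) : Rbar :=
  lim2 (fun rho K =>
    bounded_integral (pmap (fun y => Rmax y (- K)) (neg_part f)) (- rho) rho).

Definition integrable (f : pfun) : Prop :=
  quasicontinuous_on line f /\
  (is_finite (integral_pos f) \/ is_finite (integral_neg f)).

(* Meaningful for integrable [f]: the case (+oo) + (-oo), where [Rbar_plus]
   returns 0, is then excluded. *)
Definition integral (f : pfun) : Rbar :=
  Rbar_plus (integral_pos f) (integral_neg f).

(* Convergence of a sequence of extended reals, in the order topology of Rbar;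
   Coquelicot's [is_lim_seq] only covers real sequences. *)
Definition is_lim_seq_Rbar (u : nat -> Rbar) (l : Rbar) : Prop :=
  (forall a : R, Rbar_lt a l -> eventually (fun n => Rbar_lt a (u n))) /\
  (forall b : R, Rbar_lt l b -> eventually (fun n => Rbar_lt (u n) b)).

(* Main.v *)
Require Import Defs.
From Stdlib Require Import Reals Lra Lia List FinFun Cantor ClassicalEpsilon Classical.
From Coquelicot Require Import Coquelicot.
Open Scope R_scope.

(** Since the limit function is nonnegative almost everywhere, its integral is the
    supremum over [rho] and [N] of the integrals of [min (f, N)] over
    [-rho <= x <= rho] ([integral_pos_is_sup2], [integral_ae_nonneg]), and the
    same holds for each [fn n].  Two suprema commute, so monotone convergence
    reduces to three facts: the limit is quasicontinuous
    ([limit_quasicontinuous]), truncated integrals are monotone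
    ([truncated_integral_le]), and each truncated integral of [f] is approached
    by those of the [fn n] ([truncated_integral_limit]).

    No theory of measurable sets is used, only covers by intervals.  The basic
    estimate is [RInt_le_off_thin]: a continuous function that is at most [M]
    everywhere, and at most [eta] off a set covered by intervals of total length
    [e], has integral at most [eta * (k - h) + M * e] over a segment from [h] to
    [k].  Applied to the continuous functions that compute two Tonelli integrals,
    it gives the comparison principle [is_bounded_integral_le], from which the
    independence of the choices, the monotonicity of the integral and the passage
    to a limit that is uniform off a small set all follow.  That the integral of a
    bounded quasicontinuous function exists also requires continuous extensions
    with the same bounds, which are written down explicitly ([tietze_1_2]).

    Uniformity off a small set is Egorov's theorem
    ([almost_uniform_convergence]), which is elementary for increasing sequences.
    After composition with a bounded increasing function, the [fn n] agree, off a
    small set, with an increasing sequence of continuous functions.  The Riemann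
    integrals of these are bounded, so from some index on they increase by very
    little, and Chebyshev's inequality for the supremum of a sequence
    ([thin_superlevel]) shows that, off another small set, the functions increase
    by little as well.  With the arctangent as bounded function this gives the
    quasicontinuity of [f], as a uniform limit of continuous functions is
    continuous; with truncation at [N] it gives the limit of the truncated
    integrals. *)

(** * Sets that can be covered by intervals of small total length *)

Lemma sum_n_succ (a : nat -> R) (n : nat) : sum_n a (S n) = sum_n a n + a (S n).
Proof. exact (sum_Sn a n). Qed.

Lemma sum_n_zero (a : nat -> R) : sum_n a 0 = a 0%nat.
Proof. exact (sum_O a). Qed.

Lemma sum_n_le_sum_n (a b : nat -> R) (N : nat) :
  (forall n, a n <= b n) -> sum_n a N <= sum_n b N.
Proof. intros H. apply sum_n_m_le, H. Qed.

Lemma sum_n_add (a b : nat -> R) (N : nat) :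
  sum_n (fun n => a n + b n) N = sum_n a N + sum_n b N.
Proof. exact (sum_n_plus a b N). Qed.

Lemma sum_n_nonneg (a : nat -> R) (N : nat) : (forall n, 0 <= a n) -> 0 <= sum_n a N.
Proof.
  intros H. induction N as [|N IH].
  - rewrite sum_n_zero. apply H.
  - rewrite sum_n_succ. specialize (H (S N)). lra.
Qed.

Lemma sum_n_increasing (a : nat -> R) (N M : nat) :
  (forall n, 0 <= a n) -> (N <= M)%nat -> sum_n a N <= sum_n a M.
Proof.
  intros H HNM. induction HNM as [|M HNM IH]; [lra|].
  rewrite sum_n_succ. specialize (H (S M)). lra.
Qed.

Lemma term_le_sum_n (a : nat -> R) (N : nat) :
  (forall n, 0 <= a n) -> a N <= sum_n a N.
Proof.
  intros H. destruct N as [|N].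
  - rewrite sum_n_zero. lra.
  - rewrite sum_n_succ. assert (H1 := sum_n_nonneg a N H). lra.
Qed.

Lemma sum_n_halves (e : R) (N : nat) :
  sum_n (fun n => e * (/ 2) ^ S n) N = e - e * (/ 2) ^ S N.
Proof.
  induction N as [|N IH].
  - rewrite sum_n_zero. simpl. lra.
  - rewrite sum_n_succ, IH. simpl. lra.
Qed.

Lemma half_pow_pos (n : nat) : 0 < (/ 2) ^ n.
Proof. apply pow_lt. lra. Qed.

Lemma sum_n_halves_le (e : R) (N : nat) :
  0 <= e -> sum_n (fun n => e * (/ 2) ^ S n) N <= e.
Proof.
  intros He. rewrite sum_n_halves.
  assert (H := half_pow_pos (S N)). nra.
Qed.

Lemma le_of_le_add_mult (x y C : R) :
  0 <= C -> (forall t, 0 < t -> x <= y + C * t) -> x <= y.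
Proof.
  intros HC H. apply Rnot_lt_le. intros Hlt.
  assert (Ht : 0 < (x - y) / (2 * (C + 1))) by (apply Rdiv_lt_0_compat; lra).
  specialize (H _ Ht).
  assert (E : (x - y) / (2 * (C + 1)) * (2 * (C + 1)) = x - y) by (field; lra).
  nra.
Qed.

(** Closed intervals, which may be degenerate, are easier to produce than the
    terms of a multiinterval, and bounds on partial sums are easier to combine
    than the extended real total length; [thin_multiinterval] converts at the
    cost of an arbitrarily small increase of the length. *)
Definition thin (e : R) (A : R -> Prop) : Prop :=
  exists a b : nat -> R,
    (forall n, a n <= b n) /\
    (forall N, sum_n (fun n => b n - a n) N <= e) /\
    (forall x, A x -> exists n, a n <= x <= b n).

Lemma thin_subset (e e' : R) (A B : R -> Prop) :
  thin e A -> e <= e' -> (forall x, B x -> A x) -> thin e' B.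
Proof.
  intros (a & b & Hab & Hs & Hc) He HBA. exists a, b. split; [exact Hab|split].
  - intros N. specialize (Hs N). lra.
  - intros x Hx. apply Hc, HBA, Hx.
Qed.

Lemma thin_length_nonneg (e : R) (A : R -> Prop) : thin e A -> 0 <= e.
Proof.
  intros (a & b & Hab & Hs & _). specialize (Hs 0%nat). rewrite sum_n_zero in Hs.
  specialize (Hab 0%nat). lra.
Qed.

Lemma thin_multiinterval (s e : R) (A : R -> Prop) :
  thin s A -> s < e ->
  exists D : multiinterval, Rbar_lt (mlength D) e /\ forall x, A x -> mcover D x.
Proof.
  intros (a & b & Hab & Hs & Hc) He.
  (* enlarging both sides by [g n] costs at most [(e - s) / 2] in total *)
  set (g := fun n : nat => (e - s) / 4 * (/ 2) ^ S n).
  assert (Hg : forall n, 0 < g n).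
  { intros n. unfold g. assert (H := half_pow_pos (S n)). nra. }
  assert (Hle : forall n, a n - g n <= b n + g n).
  { intros n. specialize (Hab n). specialize (Hg n). lra. }
  assert (Hlt : exists n, a n - g n < b n + g n).
  { exists 0%nat. specialize (Hab 0%nat). specialize (Hg 0%nat). lra. }
  exists (MultiInterval _ _ Hle Hlt). split.
  - unfold mlength. cbn [lft rgt].
    apply Rbar_le_lt_trans with (Finite ((s + e) / 2)); [|simpl; lra].
    rewrite <- (Lim_seq_const ((s + e) / 2)).
    apply Lim_seq_le_loc. exists 0%nat. intros N _.
    rewrite (sum_n_ext _ (fun n => (b n - a n) + (g n + g n)))
      by (intros n; simpl; lra).
    rewrite !sum_n_add.
    assert (H1 := Hs N).
    assert (H2 : sum_n g N <= (e - s) / 4) by (apply sum_n_halves_le; lra).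
    lra.
  - intros x Hx. destruct (Hc x Hx) as [n Hn]. exists n. cbn [lft rgt].
    specialize (Hg n). lra.
Qed.

Lemma mlength_partial_sums (D : multiinterval) (e : R) (N : nat) :
  Rbar_lt (mlength D) e -> sum_n (fun n => rgt D n - lft D n) N <= e.
Proof.
  intros HD. apply Rnot_lt_le. intros Hlt.
  apply (Rbar_lt_not_le _ _ HD). unfold mlength.
  rewrite <- (Lim_seq_const e).
  apply Lim_seq_le_loc. exists N. intros M HM.
  apply Rle_trans with (1 := Rlt_le _ _ Hlt). apply sum_n_increasing; [|exact HM].
  intros n. assert (H := lft_le_rgt D n). lra.
Qed.

Lemma thin_mcover (D : multiinterval) (e : R) :
  Rbar_lt (mlength D) e -> thin e (mcover D).
Proof.
  intros HD. exists (lft D), (rgt D). split; [apply lft_le_rgt|split].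
  - intros N. now apply mlength_partial_sums.
  - intros x [n Hn]. exists n. lra.
Qed.

Fixpoint list_sum {T : Type} (f : T -> R) (l : list T) : R :=
  match l with
  | nil => 0
  | x :: l => f x + list_sum f l
  end.

Lemma list_sum_app {T : Type} (f : T -> R) (l m : list T) :
  list_sum f (l ++ m) = list_sum f l + list_sum f m.
Proof. induction l as [|x l IH]; simpl; lra. Qed.

Lemma list_sum_map {T U : Type} (g : T -> U) (f : U -> R) (l : list T) :
  list_sum f (map g l) = list_sum (fun x => f (g x)) l.
Proof. induction l as [|x l IH]; simpl; lra. Qed.

Lemma list_sum_nonneg {T : Type} (f : T -> R) (l : list T) :
  (forall x, 0 <= f x) -> 0 <= list_sum f l.
Proof. intros H. induction l as [|x l IH]; simpl; [lra|]. specialize (H x). lra. Qed.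

Lemma list_sum_incl {T : Type} (f : T -> R) (l m : list T) :
  (forall x, 0 <= f x) -> NoDup l -> incl l m -> list_sum f l <= list_sum f m.
Proof.
  intros Hf. revert m. induction l as [|x l IH]; intros m Hl Hm; simpl.
  - apply list_sum_nonneg, Hf.
  - apply NoDup_cons_iff in Hl. destruct Hl as [Hx Hl].
    destruct (in_split x m) as (m1 & m2 & ->); [apply Hm; now left|].
    rewrite list_sum_app. simpl.
    assert (H : list_sum f l <= list_sum f (m1 ++ m2)).
    { apply IH; [exact Hl|]. intros y Hy.
      assert (Hy' := Hm y (or_intror Hy)). apply in_app_iff in Hy'.
      apply in_app_iff. destruct Hy' as [H|[H|H]]; [now left| |now right].
      subst y. contradiction. }
    rewrite list_sum_app in H. lra.
Qed.

Lemma list_sum_seq (a : nat -> R) (N : nat) : list_sum a (seq 0 (S N)) = sum_n a N.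
Proof.
  induction N as [|N IH].
  - rewrite sum_n_zero. simpl. lra.
  - rewrite seq_S, list_sum_app, IH, sum_n_succ. simpl. lra.
Qed.

Lemma list_sum_prod (a : nat -> nat -> R) (l m : list nat) :
  list_sum (fun p => a (fst p) (snd p)) (list_prod l m)
  = list_sum (fun i => list_sum (a i) m) l.
Proof.
  induction l as [|i l IH]; simpl; [reflexivity|].
  rewrite list_sum_app, list_sum_map, IH. reflexivity.
Qed.

(** Cantor's pairing function is at least the sum of its arguments, so that the
    first terms of the enumeration lie in a square. *)
Lemma sum_n_cantor (a : nat -> nat -> R) (e : nat -> R) (s : R) :
  (forall i j, 0 <= a i j) ->
  (forall i N, sum_n (a i) N <= e i) ->
  (forall N, sum_n e N <= s) ->
  forall N, sum_n (fun p => a (fst (of_nat p)) (snd (of_nat p))) N <= s.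
Proof.
  intros Ha He Hs N. set (l := seq 0 (S N)).
  rewrite <- list_sum_seq. fold l.
  rewrite <- (list_sum_map of_nat (fun q => a (fst q) (snd q)) l).
  apply Rle_trans with
    (list_sum (fun q => a (fst q) (snd q)) (list_prod l l)).
  - apply list_sum_incl.
    + intros q. apply Ha.
    + apply FinFun.Injective_map_NoDup; [|apply seq_NoDup].
      intros p q Hpq. rewrite <- (cancel_to_of p), <- (cancel_to_of q). now rewrite Hpq.
    + intros [i j] Hq. apply in_map_iff in Hq. destruct Hq as (p & Hp & Hpl).
      apply in_seq in Hpl.
      assert (H := to_nat_non_decreasing i j). rewrite <- Hp, cancel_to_of in H.
      apply in_prod; apply in_seq; lia.
  - rewrite list_sum_prod. unfold l. rewrite list_sum_seq.
    apply Rle_trans with (2 := Hs N). apply sum_n_le_sum_n. intros i.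
    rewrite list_sum_seq. apply He.
Qed.

Lemma choice {T U : Type} (P : T -> U -> Prop) :
  (forall x, exists y, P x y) -> exists c, forall x, P x (c x).
Proof.
  intros H. exists (fun x => proj1_sig (constructive_indefinite_description _ (H x))).
  intros x. apply proj2_sig.
Qed.

Lemma thin_countable_union (e : nat -> R) (s : R) (A : nat -> R -> Prop) :
  (forall n, thin (e n) (A n)) -> (forall N, sum_n e N <= s) ->
  thin s (fun x => exists n, A n x).
Proof.
  intros HA Hs.
  assert (HA' : forall n, exists ab : (nat -> R) * (nat -> R),
    (forall j, fst ab j <= snd ab j) /\
    (forall N, sum_n (fun j => snd ab j - fst ab j) N <= e n) /\
    (forall x, A n x -> exists j, fst ab j <= x <= snd ab j)).
  { intros n. destruct (HA n) as (a & b & H). now exists (a, b). }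
  destruct (choice _ HA') as [c Hc].
  exists (fun p => fst (c (fst (of_nat p))) (snd (of_nat p))),
         (fun p => snd (c (fst (of_nat p))) (snd (of_nat p))).
  split; [|split].
  - intros p. apply (proj1 (Hc _)).
  - apply (sum_n_cantor (fun i j => snd (c i) j - fst (c i) j) e s).
    + intros i j. assert (H := proj1 (Hc i) j). lra.
    + intros i N. apply (proj1 (proj2 (Hc i))).
    + exact Hs.
  - intros x [n Hx]. destruct (proj2 (proj2 (Hc n)) x Hx) as [j Hj].
    exists (to_nat (n, j)). rewrite cancel_of_to. exact Hj.
Qed.

Lemma thin_countable_union_halves (e : R) (A : nat -> R -> Prop) :
  0 <= e -> (forall n, thin (e * (/ 2) ^ S n) (A n)) ->
  thin e (fun x => exists n, A n x).
Proof.
  intros He HA. apply thin_countable_union with (1 := HA).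
  intros N. now apply sum_n_halves_le.
Qed.

Lemma thin_segment (u v : R) : u <= v -> thin (v - u) (fun x => u <= x <= v).
Proof.
  intros Huv. exists (fun _ => u), (fun n => match n with O => v | _ => u end).
  split; [|split].
  - intros [|n]; lra.
  - intros N. induction N as [|N IH].
    + rewrite sum_n_zero. lra.
    + rewrite sum_n_succ. lra.
  - intros x Hx. now exists 0%nat.
Qed.

Lemma thin_empty (A : R -> Prop) : (forall x, ~ A x) -> thin 0 A.
Proof.
  intros HA. apply thin_subset with (0 - 0) (fun x => 0 <= x <= 0).
  - apply thin_segment. lra.
  - lra.
  - intros x Hx. elim (HA x Hx).
Qed.

Lemma thin_union (e1 e2 : R) (A B : R -> Prop) :
  thin e1 A -> thin e2 B -> thin (e1 + e2) (fun x => A x \/ B x).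
Proof.
  intros HA HB.
  apply thin_subset with (e1 + e2) (fun x => exists n : nat,
    match n with O => A | S O => B | _ => fun _ => False end x).
  - apply thin_countable_union
      with (fun n => match n with O => e1 | S O => e2 | _ => 0 end).
    + intros [|[|n]]; [exact HA|exact HB|]. apply thin_empty. tauto.
    + assert (H1 := thin_length_nonneg _ _ HA). assert (H2 := thin_length_nonneg _ _ HB).
      intros [|N]; [rewrite sum_n_zero; lra|].
      induction N as [|N IH]; rewrite sum_n_succ; [rewrite sum_n_zero|]; lra.
  - lra.
  - intros x [Hx|Hx]; [now exists 0%nat|now exists 1%nat].
Qed.

Lemma null_set_thin (A : R -> Prop) (e : R) : null_set A -> 0 < e -> thin e A.
Proof.
  intros HA He. destruct (HA (mkposreal e He)) as (D & HD & Hc).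
  apply thin_subset with (1 := thin_mcover D e HD); [lra|exact Hc].
Qed.

(** * Passing from local to global inequalities between integrals *)

(** Cousin's lemma: the form of compactness suited to inequalities between
    additive functions of an interval, such as an integral and the length that a
    cover spends on the interval.  The supremum of the points that can be reached
    from [h] can be passed, by the local hypothesis, unless it is [k]. *)
Lemma cousin (P : R -> R -> Prop) (h k : R) :
  h <= k ->
  (forall u w v, h <= u <= w -> w <= v <= k -> P u w -> P w v -> P u v) ->
  (forall x, h <= x <= k -> exists d, 0 < d /\
     forall u v, h <= u <= x -> x <= v <= k -> x - d < u -> v < x + d -> P u v) ->
  P h k.
Proof.
  intros Hhk Hadd Hloc.
  set (E := fun y => h <= y <= k /\ P h y).
  assert (Eh : E h).
  { split; [lra|]. destruct (Hloc h) as (d & Hd & H); [lra|]. apply H; lra. }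
  destruct (completeness E) as [s [Hub Hlub]].
  { exists k. intros y [Hy _]. lra. }
  { now exists h. }
  assert (Hs : h <= s <= k).
  { split; [apply Hub, Eh|]. apply Hlub. intros y [Hy _]. lra. }
  destruct (Hloc s Hs) as (d & Hd & Hd').
  assert (Hy : exists y, E y /\ s - d < y).
  { apply NNPP. intros Hn. assert (s <= s - d); [|lra].
    apply Hlub. intros y Ey. apply Rnot_lt_le. intros Hlt. apply Hn. now exists y. }
  destruct Hy as (y & [Hy HPy] & Hsy).
  assert (Hys : y <= s) by (apply Hub; now split).
  set (v := Rmin k (s + d / 2)).
  assert (Hv : s <= v <= k /\ v < s + d).
  { unfold v, Rmin. destruct (Rle_dec k (s + d / 2)); lra. }
  assert (HPv : P h v).
  { apply Hadd with y; [lra|lra|exact HPy|]. apply Hd'; lra. }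
  assert (Hvs : v <= s) by (apply Hub; split; [lra|exact HPv]).
  assert (Hvk : v = k).
  { unfold v, Rmin in Hvs |- *. destruct (Rle_dec k (s + d / 2)); lra. }
  now rewrite <- Hvk.
Qed.

Lemma continuous_ex_RInt (g : R -> R) (u v : R) :
  (forall x, continuous g x) -> ex_RInt g u v.
Proof. intros Hg. apply (ex_RInt_continuous g). intros z _. apply Hg. Qed.

Lemma RInt_split (g : R -> R) (u w v : R) :
  (forall x, continuous g x) -> RInt g u v = RInt g u w + RInt g w v.
Proof.
  intros Hg. symmetry. apply (RInt_Chasles g); now apply continuous_ex_RInt.
Qed.

Lemma RInt_constant (C u v : R) : RInt (fun _ => C) u v = C * (v - u).
Proof. rewrite RInt_const. unfold scal. simpl. unfold mult. simpl. ring. Qed.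

Lemma RInt_le_const (g : R -> R) (u v C : R) :
  (forall x, continuous g x) -> u <= v -> (forall x, u < x < v -> g x <= C) ->
  RInt g u v <= C * (v - u).
Proof.
  intros Hg Huv HC. rewrite <- RInt_constant.
  apply RInt_le; [exact Huv|now apply continuous_ex_RInt|apply ex_RInt_const|exact HC].
Qed.

Lemma RInt_const_le (g : R -> R) (u v C : R) :
  (forall x, continuous g x) -> u <= v -> (forall x, u < x < v -> C <= g x) ->
  C * (v - u) <= RInt g u v.
Proof.
  intros Hg Huv HC. rewrite <- RInt_constant.
  apply RInt_le; [exact Huv|apply ex_RInt_const|now apply continuous_ex_RInt|exact HC].
Qed.

Lemma RInt_le_continuous (f g : R -> R) (u v : R) :
  (forall x, continuous f x) -> (forall x, continuous g x) -> u <= v ->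
  (forall x, f x <= g x) -> RInt f u v <= RInt g u v.
Proof.
  intros Hf Hg Huv H. apply RInt_le; [exact Huv| | |intros x _; apply H];
    now apply continuous_ex_RInt.
Qed.

Lemma RInt_minus_continuous (f g : R -> R) (u v : R) :
  (forall x, continuous f x) -> (forall x, continuous g x) ->
  RInt (fun x => f x - g x) u v = RInt f u v - RInt g u v.
Proof.
  intros Hf Hg. apply (RInt_minus f g); now apply continuous_ex_RInt.
Qed.

Lemma continuous_locally_lt (g : R -> R) (x C : R) :
  continuous g x -> g x < C -> exists d, 0 < d /\ forall y, Rabs (y - x) < d -> g y < C.
Proof.
  intros Hg HC.
  assert (H : locally (g x) (fun z => z < C)) by now apply (open_lt C).
  destruct (Hg _ H) as [d Hd]. exists d. split; [apply cond_pos|].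
  intros y Hy. now apply Hd.
Qed.

(** The length of the intersection of the intervals from [a] to [b] and from [u]
    to [v]. *)
Definition common_length (a b u v : R) : R := Rmax 0 (Rmin b v - Rmax a u).

Lemma common_length_split (a b u w v : R) :
  a <= b -> u <= w <= v ->
  common_length a b u v = common_length a b u w + common_length a b w v.
Proof.
  intros Hab Hw. unfold common_length, Rmax, Rmin.
  repeat destruct (Rle_dec _ _); lra.
Qed.

Lemma common_length_le (a b u v : R) : a <= b -> common_length a b u v <= b - a.
Proof.
  intros Hab. unfold common_length, Rmax, Rmin. repeat destruct (Rle_dec _ _); lra.
Qed.

Lemma common_length_inside (a b u v : R) :
  a <= u -> u <= v -> v <= b -> common_length a b u v = v - u.
Proof.
  intros H1 H2 H3. unfold common_length, Rmax, Rmin. repeat destruct (Rle_dec _ _); lra.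
Qed.

Lemma common_length_nonneg (a b u v : R) : 0 <= common_length a b u v.
Proof. apply Rmax_l. Qed.

(** Near a point of the cover the integral is at most [M] times the length of the
    cover; near any other point the function is below [eta + t] by continuity.
    Both estimates are additive, so that [cousin] applies. *)
Lemma RInt_le_off_thin (g : R -> R) (h k M eta e : R) (A : R -> Prop) :
  (forall x, continuous g x) -> h <= k -> 0 <= M -> 0 <= eta ->
  (forall x, h <= x <= k -> g x <= M) -> thin e A ->
  (forall x, h <= x <= k -> ~ A x -> g x <= eta) ->
  RInt g h k <= eta * (k - h) + M * e.
Proof.
  intros Hg Hhk HM Heta HgM HA HgA.
  apply le_of_le_add_mult with (k - h + M); [lra|]. intros t Ht.
  destruct (thin_multiinterval e (e + t) A HA) as (D & HD & HAD); [lra|].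
  assert (Hs := fun N => mlength_partial_sums D (e + t) N HD).
  set (len := fun u v n => common_length (lft D n) (rgt D n) u v).
  assert (Hlen : forall u v n, 0 <= len u v n) by (intros; apply common_length_nonneg).
  assert (H : exists N, RInt g h k <= (eta + t) * (k - h) + M * sum_n (len h k) N).
  { apply (cousin (fun u v => exists N,
      RInt g u v <= (eta + t) * (v - u) + M * sum_n (len u v) N)); [exact Hhk| |].
    - intros u w v Hu Hv [N1 H1] [N2 H2]. exists (max N1 N2).
      rewrite (RInt_split g u w v Hg).
      rewrite (sum_n_ext (len u v) (fun n => len u w n + len w v n)).
      2:{ intros n. apply common_length_split; [apply lft_le_rgt|lra]. }
      rewrite sum_n_add.
      assert (H3 := sum_n_increasing (len u w) N1 (max N1 N2) (Hlen u w) ltac:(lia)).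
      assert (H4 := sum_n_increasing (len w v) N2 (max N1 N2) (Hlen w v) ltac:(lia)).
      nra.
    - intros x Hx. destruct (classic (mcover D x)) as [[n Hn]|Hn].
      + exists (Rmin (x - lft D n) (rgt D n - x)). split; [apply Rmin_pos; lra|].
        intros u v Hu Hv Hu' Hv'. exists n.
        assert (H1 := Rmin_l (x - lft D n) (rgt D n - x)).
        assert (H2 := Rmin_r (x - lft D n) (rgt D n - x)).
        assert (H3 : RInt g u v <= M * (v - u)).
        { apply RInt_le_const; [exact Hg|lra|]. intros y Hy. apply HgM. lra. }
        assert (H4 := term_le_sum_n (len u v) n (Hlen u v)).
        unfold len at 1 in H4. rewrite common_length_inside in H4 by lra.
        nra.
      + assert (Hgx : g x < eta + t).
        { assert (g x <= eta); [|lra]. apply HgA; [exact Hx|].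
          intros HAx. apply Hn, HAD, HAx. }
        destruct (continuous_locally_lt g x _ (Hg x) Hgx) as (d & Hd & Hd').
        exists d. split; [exact Hd|]. intros u v Hu Hv Hu' Hv'. exists 0%nat.
        assert (H3 : RInt g u v <= (eta + t) * (v - u)).
        { apply RInt_le_const; [exact Hg|lra|]. intros y Hy. left. apply Hd'.
          apply Rabs_def1; lra. }
        assert (H4 := sum_n_nonneg (len u v) 0 (Hlen u v)).
        nra. }
  destruct H as [N HN].
  assert (H1 : sum_n (len h k) N <= e + t).
  { apply Rle_trans with (2 := Hs N). apply sum_n_le_sum_n. intros n.
    apply common_length_le, lft_le_rgt. }
  nra.
Qed.

(** * Continuous extension from a closed set *)

Lemma continuous_eps (g : R -> R) (x : R) :
  continuous g x <->
  forall eps, 0 < eps -> exists d, 0 < d /\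
    forall y, Rabs (y - x) < d -> Rabs (g y - g x) < eps.
Proof.
  split.
  - intros Hg eps Heps.
    destruct (Hg (ball (g x) (mkposreal eps Heps))) as [d Hd].
    { now exists (mkposreal eps Heps). }
    exists d. split; [apply cond_pos|]. intros y Hy. now apply Hd.
  - intros H P [eps HP]. destruct (H eps (cond_pos eps)) as (d & Hd & Hy).
    exists (mkposreal d Hd). intros y Hxy. apply HP. now apply Hy.
Qed.

Lemma continuous_on_eps (S : R -> Prop) (g : R -> R) :
  continuous_on S g <->
  forall x, S x -> forall eps, 0 < eps -> exists d, 0 < d /\
    forall y, S y -> Rabs (y - x) < d -> Rabs (g y - g x) < eps.
Proof.
  split.
  - intros Hg x Hx eps Heps.
    destruct (Hg x Hx (ball (g x) (mkposreal eps Heps))) as [d Hd].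
    { now exists (mkposreal eps Heps). }
    exists d. split; [apply cond_pos|]. intros y Sy Hy. now apply Hd.
  - intros H x Hx P [eps HP]. destruct (H x Hx eps (cond_pos eps)) as (d & Hd & Hy).
    exists (mkposreal d Hd). intros y Hxy Sy. apply HP. now apply Hy.
Qed.

Lemma Lipschitz_continuous (g : R -> R) (K : R) :
  0 < K -> (forall x y, g x <= g y + K * Rabs (x - y)) -> forall x, continuous g x.
Proof.
  intros HK H x. apply continuous_eps. intros eps Heps.
  exists (eps / K). split; [now apply Rdiv_lt_0_compat|]. intros y Hy.
  assert (H1 := H x y). assert (H2 := H y x). rewrite (Rabs_minus_sym x y) in H1.
  assert (E : eps / K * K = eps) by (field; lra).
  apply Rabs_def1; nra.
Qed.

Lemma inf_exists (I : R -> Prop) (g : R -> R) :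
  (exists s, I s) -> (forall s, I s -> 0 <= g s) ->
  exists m, (forall s, I s -> m <= g s) /\
            (forall c, (forall s, I s -> c <= g s) -> c <= m).
Proof.
  intros [s0 Hs0] Hg.
  set (E := fun y => exists s, I s /\ y = g s).
  destruct (Glb_Rbar_correct E) as [Hlb Hglb].
  assert (H0 : Rbar_le 0 (Glb_Rbar E)).
  { apply Hglb. intros y (s & Hs & ->). apply Hg, Hs. }
  assert (H1 : Rbar_le (Glb_Rbar E) (g s0)) by (apply Hlb; now exists s0).
  destruct (Glb_Rbar E) as [m| |]; try contradiction.
  exists m. split.
  - intros s Hs. apply (Hlb (g s)). now exists s.
  - intros c Hc. apply (Hglb c). intros y (s & Hs & ->). apply Hc, Hs.
Qed.

(** Hausdorff's form of Tietze's theorem, for a function with values in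
    the interval from 1 to 2: off [S], the extension is the infimum over [s] of
    [w s * |x - s|] divided by the distance from [x] to [S].  Both are Lipschitz,
    and close to a point of [S] only the values of [w] near that point matter. *)
Lemma tietze_1_2 (S : R -> Prop) (w : R -> R) :
  (exists s, S s) ->
  (forall x, ~ S x -> exists d, 0 < d /\ forall s, S s -> d <= Rabs (x - s)) ->
  continuous_on S w -> (forall s, S s -> 1 <= w s <= 2) ->
  exists phi : R -> R, (forall x, continuous phi x) /\
    (forall s, S s -> phi s = w s) /\
    (forall a, (forall s, S s -> a <= w s) -> forall x, a <= phi x) /\
    (forall b, (forall s, S s -> w s <= b) -> forall x, phi x <= b).
Proof.
  intros HS Hclosed Hw Hw12.
  destruct (choice (fun x m =>
     (forall s, S s -> m <= w s * Rabs (x - s)) /\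
     (forall c, (forall s, S s -> c <= w s * Rabs (x - s)) -> c <= m))) as [I HI].
  { intros x. apply (inf_exists S (fun s => w s * Rabs (x - s)) HS).
    intros s Hs. specialize (Hw12 s Hs). assert (H := Rabs_pos (x - s)). nra. }
  destruct (choice (fun x m =>
     (forall s, S s -> m <= Rabs (x - s)) /\
     (forall c, (forall s, S s -> c <= Rabs (x - s)) -> c <= m))) as [d Hd].
  { intros x. apply (inf_exists S (fun s => Rabs (x - s)) HS).
    intros s Hs. apply Rabs_pos. }
  assert (I_cont : forall x, continuous I x).
  { apply Lipschitz_continuous with 2; [lra|]. intros x y.
    assert (I x - 2 * Rabs (x - y) <= I y); [|lra].
    apply (HI y). intros s Hs. assert (H1 := proj1 (HI x) s Hs).
    assert (H2 := Rabs_triang (x - y) (y - s)).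
    replace (x - y + (y - s)) with (x - s) in H2 by ring.
    specialize (Hw12 s Hs). assert (H3 := Rabs_pos (x - y)). nra. }
  assert (d_cont : forall x, continuous d x).
  { apply Lipschitz_continuous with 1; [lra|]. intros x y.
    assert (d x - 1 * Rabs (x - y) <= d y); [|lra].
    apply (Hd y). intros s Hs. assert (H1 := proj1 (Hd x) s Hs).
    assert (H2 := Rabs_triang (x - y) (y - s)).
    replace (x - y + (y - s)) with (x - s) in H2 by ring. lra. }
  assert (d_pos : forall x, ~ S x -> 0 < d x).
  { intros x Hx. destruct (Hclosed x Hx) as (r & Hr & Hrs).
    apply Rlt_le_trans with (1 := Hr). now apply (Hd x). }
  assert (I_pos : forall x, 0 <= I x).
  { intros x. apply (HI x). intros s Hs. specialize (Hw12 s Hs).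
    assert (H := Rabs_pos (x - s)). nra. }
  assert (d_pos' : forall x, 0 <= d x).
  { intros x. apply (Hd x). intros s Hs. apply Rabs_pos. }
  set (phi := fun x => if excluded_middle_informative (S x) then w x else I x / d x).
  assert (phi_in : forall x, S x -> phi x = w x).
  { intros x Hx. unfold phi. now destruct (excluded_middle_informative (S x)). }
  assert (phi_out : forall x, ~ S x -> phi x = I x / d x).
  { intros x Hx. unfold phi. now destruct (excluded_middle_informative (S x)). }
  assert (lower : forall x c, ~ S x -> c * d x <= I x -> c <= phi x).
  { intros x c Hx Hc. rewrite (phi_out x Hx). apply Rle_div_r; [now apply d_pos|exact Hc]. }
  assert (upper : forall x c, ~ S x -> I x <= c * d x -> phi x <= c).
  { intros x c Hx Hc. rewrite (phi_out x Hx). apply Rle_div_l; [now apply d_pos|exact Hc]. }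
  assert (upper' : forall x c, ~ S x -> 0 < c ->
            (forall s, S s -> I x <= c * Rabs (x - s)) -> phi x <= c).
  { intros x c Hx Hc H. apply (upper x c Hx).
    assert (H1 : I x / c <= d x).
    { apply (Hd x). intros s Hs. apply Rle_div_l; [lra|].
      rewrite Rmult_comm. now apply H. }
    apply Rle_div_l in H1; [|lra]. lra. }
  exists phi. split; [|split; [exact phi_in|split]].
  - intros x. destruct (classic (S x)) as [Sx|Sx].
    + apply continuous_eps. intros eps Heps.
      destruct (proj1 (continuous_on_eps S w) Hw x Sx (eps / 2)) as (r & Hr & Hwr); [lra|].
      exists (r / 4). split; [lra|]. intros y Hy.
      rewrite (phi_in x Sx). destruct (classic (S y)) as [Sy|Sy].
      { rewrite (phi_in y Sy). apply Rlt_trans with (eps / 2); [|lra].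
        apply Hwr; [exact Sy|lra]. }
      assert (Hdy : d y <= Rabs (y - x)) by now apply (Hd y).
      assert (Hdy0 := d_pos y Sy).
      assert (Hwx := Hw12 x Sx).
      (* points of [S] at distance at least [r] from [x] are far from [y] *)
      assert (far : forall s, r <= Rabs (s - x) -> 3 / 4 * r <= Rabs (y - s)).
      { intros s Hs. assert (H := Rabs_triang (s - y) (y - x)).
        replace (s - y + (y - x)) with (s - x) in H by ring.
        rewrite (Rabs_minus_sym s y) in H. lra. }
      assert (Hlow : w x - eps / 2 <= phi y).
      { apply (lower y _ Sy). apply (HI y). intros s Ss.
        assert (Hws := Hw12 s Ss). assert (Hds := proj1 (Hd y) s Ss).
        destruct (Rlt_le_dec (Rabs (s - x)) r) as [Hs|Hs].
        - assert (H := Hwr s Ss Hs). apply Rabs_def2 in H. nra.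
        - assert (H := far s Hs). nra. }
      assert (Hup : phi y <= w x + eps / 2).
      { apply (upper' y _ Sy); [lra|]. intros s Ss.
        assert (HIs := proj1 (HI y) s Ss). assert (HIx := proj1 (HI y) x Sx).
        destruct (Rlt_le_dec (Rabs (s - x)) r) as [Hs|Hs].
        - assert (H := Hwr s Ss Hs). apply Rabs_def2 in H.
          assert (H' := Rabs_pos (y - s)). nra.
        - assert (H := far s Hs). nra. }
      apply Rabs_def1; lra.
    + apply continuous_ext_loc with (fun y => I y / d y).
      * destruct (Hclosed x Sx) as (r & Hr & Hrs).
        exists (mkposreal r Hr). intros y Hy. symmetry. apply phi_out. intros Sy.
        assert (H := Hrs y Sy). rewrite Rabs_minus_sym in H.
        assert (H' : Rabs (y - x) < r) by exact Hy. lra.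
      * apply (continuous_mult I (fun y => / d y)); [apply I_cont|].
        apply (continuous_comp d Rinv); [apply d_cont|].
        apply continuous_Rinv. assert (H := d_pos x Sx). lra.
  - intros a Ha x. destruct (classic (S x)) as [Sx|Sx].
    + rewrite (phi_in x Sx). now apply Ha.
    + apply (lower x a Sx). apply (HI x). intros s Ss.
      assert (H1 := Ha s Ss). assert (H2 := Hw12 s Ss). assert (H3 := proj1 (Hd x) s Ss).
      assert (H4 := d_pos' x).
      destruct (Rle_lt_dec 0 a); nra.
  - intros b Hb x. destruct (classic (S x)) as [Sx|Sx].
    + rewrite (phi_in x Sx). now apply Hb.
    + apply (upper' x b Sx).
      * destruct HS as [s Ss]. specialize (Hb s Ss). specialize (Hw12 s Ss). lra.
      * intros s Ss. assert (H1 := Hb s Ss). assert (H2 := proj1 (HI x) s Ss).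
        assert (H3 := Rabs_pos (x - s)). nra.
Qed.

Lemma continuous_affine (a b : R) (x : R) : continuous (fun y => a * y + b) x.
Proof.
  apply (continuous_plus (fun y => a * y) (fun _ => b)).
  - apply (continuous_scal_r a (fun y : R => y)), continuous_id.
  - apply continuous_const.
Qed.

(** An affine change of values reduces to [tietze_1_2].  Any bound of [f] on [S]
    remains a bound of the extension, which therefore has the same infimum and
    supremum. *)
Lemma tietze (S : R -> Prop) (f : R -> R) (M : R) :
  (exists s, S s) ->
  (forall x, ~ S x -> exists d, 0 < d /\ forall s, S s -> d <= Rabs (x - s)) ->
  continuous_on S f -> (forall s, S s -> Rabs (f s) <= M) ->
  exists phi : R -> R, (forall x, continuous phi x) /\
    (forall s, S s -> phi s = f s) /\
    (forall a, (forall s, S s -> a <= f s) -> forall x, a <= phi x) /\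
    (forall b, (forall s, S s -> f s <= b) -> forall x, phi x <= b).
Proof.
  intros HS Hclosed Hf HM.
  assert (HM0 : 0 <= M).
  { destruct HS as [s Ss]. assert (H1 := HM s Ss). assert (H2 := Rabs_pos (f s)). lra. }
  set (c := / (2 * (M + 1))).
  assert (Hc : 0 < c) by (apply Rinv_0_lt_compat; lra).
  assert (Hc1 : c * (2 * (M + 1)) = 1) by (unfold c; field; lra).
  destruct (tietze_1_2 S (fun x => c * f x + 3 / 2)) as (phi & H1 & H2 & H3 & H4);
    [exact HS|exact Hclosed| | |].
  - intros x Sx. apply (filterlim_comp _ _ _ f (fun y => c * y + 3 / 2) _ (locally (f x))).
    + now apply Hf.
    + apply (continuous_affine c (3 / 2) (f x)).
  - intros s Ss. assert (H := HM s Ss). apply Rabs_le_between in H. nra.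
  - exists (fun x => / c * phi x + - (3 / 2 * / c)).
    assert (Hic : / c = 2 * (M + 1)) by (unfold c; apply Rinv_inv).
    rewrite Hic. split; [|split; [|split]].
    + intros x. apply (continuous_comp phi (fun y => 2 * (M + 1) * y + _)); [apply H1|].
      apply continuous_affine.
    + intros s Ss. rewrite (H2 s Ss). transitivity (c * (2 * (M + 1)) * f s); [ring|].
      rewrite Hc1. ring.
    + intros a Ha x.
      assert (Hx : c * a + 3 / 2 <= phi x).
      { apply H3. intros s Ss. specialize (Ha s Ss). nra. }
      assert (E : c * (2 * (M + 1)) * a = a) by (rewrite Hc1; ring). nra.
    + intros b Hb x.
      assert (Hx : phi x <= c * b + 3 / 2).
      { apply H4. intros s Ss. specialize (Hb s Ss). nra. }
      assert (E : c * (2 * (M + 1)) * b = b) by (rewrite Hc1; ring). nra.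
Qed.

Lemma outside_segment_closed (h k : R) (D : multiinterval) (x : R) :
  ~ outside (segment h k) D x ->
  exists d, 0 < d /\ forall s, outside (segment h k) D s -> d <= Rabs (x - s).
Proof.
  intros Hx. destruct (Rlt_le_dec x h) as [Hh|Hh].
  { exists (h - x). split; [lra|]. intros s [[Hs _] _]. rewrite Rabs_minus_sym.
    apply Rle_trans with (s - x); [lra|apply Rle_abs]. }
  destruct (Rlt_le_dec k x) as [Hk|Hk].
  { exists (x - k). split; [lra|]. intros s [[_ Hs] _].
    apply Rle_trans with (x - s); [lra|apply Rle_abs]. }
  assert (HD : mcover D x).
  { apply NNPP. intros HD. apply Hx. now split; [split|]. }
  destruct HD as [n Hn]. exists (Rmin (x - lft D n) (rgt D n - x)).
  split; [apply Rmin_pos; lra|]. intros s [_ Hs]. apply Rnot_lt_le. intros Hlt.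
  apply Hs. exists n. apply Rabs_def2 in Hlt.
  assert (H1 := Rmin_l (x - lft D n) (rgt D n - x)).
  assert (H2 := Rmin_r (x - lft D n) (rgt D n - x)). lra.
Qed.

(** * The integral of bounded functions over a segment *)

Definition clamp (h k x : R) : R := Rmax h (Rmin x k).

Lemma clamp_in (h k x : R) : h <= k -> segment h k (clamp h k x).
Proof. intros H. unfold segment, clamp, Rmax, Rmin. repeat destruct (Rle_dec _ _); lra. Qed.

Lemma clamp_id (h k x : R) : segment h k x -> clamp h k x = x.
Proof.
  intros H. unfold segment, clamp, Rmax, Rmin in *. repeat destruct (Rle_dec _ _); lra.
Qed.

Lemma clamp_contract (h k x y : R) : Rabs (clamp h k y - clamp h k x) <= Rabs (y - x).
Proof.
  unfold clamp, Rmax, Rmin, Rabs.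
  repeat destruct (Rle_dec _ _); repeat destruct (Rcase_abs _); lra.
Qed.

Lemma continuous_clamp (h k : R) (g : R -> R) :
  h <= k -> continuous_on (segment h k) g ->
  forall x, continuous (fun y => g (clamp h k y)) x.
Proof.
  intros Hhk Hg x. apply continuous_eps. intros eps Heps.
  destruct (proj1 (continuous_on_eps _ g) Hg (clamp h k x) (clamp_in h k x Hhk) eps Heps)
    as (d & Hd & H).
  exists d. split; [exact Hd|]. intros y Hy. apply H; [now apply clamp_in|].
  apply Rle_lt_trans with (2 := Hy). apply clamp_contract.
Qed.

Lemma RInt_clamp (h k : R) (g : R -> R) :
  h <= k -> RInt (fun y => g (clamp h k y)) h k = RInt g h k.
Proof.
  intros Hhk. apply RInt_ext. intros x Hx.
  rewrite Rmin_left, Rmax_right in Hx by lra.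
  rewrite clamp_id; [reflexivity|]. split; lra.
Qed.

Lemma inv_INR_pos (n : nat) : 0 < / INR (n + 1).
Proof. apply Rinv_0_lt_compat, lt_0_INR. lia. Qed.

Lemma is_lim_seq_inv_INR : is_lim_seq (fun n => / INR (n + 1)) 0.
Proof.
  apply (is_lim_seq_ext (fun n => / INR (S n))).
  { intros n. now rewrite Nat.add_1_r. }
  apply (is_lim_seq_incr_1 (fun n => / INR n)).
  replace (Finite 0) with (Rbar_inv p_infty) by reflexivity.
  apply is_lim_seq_inv; [apply is_lim_seq_INR|discriminate].
Qed.

Lemma is_lim_seq_add_inv_INR (u : nat -> R) (v K : R) :
  is_lim_seq u v -> is_lim_seq (fun n => u n + K * / INR (n + 1)) v.
Proof.
  intros Hu. replace (Finite v) with (Rbar_plus v (Rbar_mult K 0)).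
  2:{ simpl. f_equal. ring. }
  apply is_lim_seq_plus'; [exact Hu|].
  apply (is_lim_seq_scal_l (fun n => / INR (n + 1)) K 0). apply is_lim_seq_inv_INR.
Qed.

Definition dominated (f : pfun) (h k M : R) : Prop :=
  forall x, segment h k x -> dom f x -> Rabs (f x) <= M.

Lemma approximating_between (f : pfun) (h k a b : R) (phi : nat -> R -> R) :
  approximating f h k phi ->
  (forall x, segment h k x -> dom f x -> a <= f x <= b) ->
  forall n x, segment h k x -> a <= phi n x <= b.
Proof.
  intros [D HD] Hab n x Hx.
  destruct (HD n) as (_ & [Hdom _] & _ & _ & Hglb & Hlub).
  set (S := outside (segment h k) (D n)) in *.
  assert (HabS : forall s, S s -> a <= f s <= b).
  { intros s Ss. apply Hab; [apply Ss|now apply Hdom]. }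
  split.
  - assert (H1 : Rbar_le a (Glb_Rbar (image f S))).
    { apply Glb_Rbar_correct. intros y (s & Ss & ->). apply HabS, Ss. }
    rewrite <- Hglb in H1.
    assert (H2 : Rbar_le (Glb_Rbar (image (phi n) (segment h k))) (phi n x)).
    { apply Glb_Rbar_correct. now exists x. }
    apply (Rbar_le_trans _ _ _ H1 H2).
  - assert (H1 : Rbar_le (Lub_Rbar (image f S)) b).
    { apply Lub_Rbar_correct. intros y (s & Ss & ->). apply HabS, Ss. }
    rewrite <- Hlub in H1.
    assert (H2 : Rbar_le (phi n x) (Lub_Rbar (image (phi n) (segment h k)))).
    { apply Lub_Rbar_correct. now exists x. }
    apply (Rbar_le_trans _ _ _ H2 H1).
Qed.

Lemma approximating_bound (f : pfun) (h k M : R) (phi : nat -> R -> R) :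
  approximating f h k phi -> dominated f h k M ->
  forall n x, segment h k x -> Rabs (phi n x) <= M.
Proof.
  intros Happ HM n x Hx. apply Rabs_le_between.
  apply (approximating_between f h k (- M) M phi Happ); [|exact Hx].
  intros y Hy Hdy. now apply Rabs_le_between, HM.
Qed.

Lemma approximating_equal (f : pfun) (h k : R) (phi : nat -> R -> R) (n : nat) :
  approximating f h k phi ->
  exists A, thin (/ INR (n + 1)) A /\
    forall x, segment h k x -> ~ A x -> dom f x /\ phi n x = f x.
Proof.
  intros [D HD]. destruct (HD n) as (Hlen & [Hdom _] & _ & Heq & _).
  exists (mcover (D n)). split; [now apply thin_mcover|].
  intros x Hx HA. split; [apply Hdom|apply Heq]; now split.
Qed.

Lemma approximating_continuous (f : pfun) (h k : R) (phi : nat -> R -> R) (n : nat) :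
  approximating f h k phi -> continuous_on (segment h k) (phi n).
Proof. intros [D HD]. apply HD. Qed.

(** Half of the comparison principle [is_bounded_integral_le]: the continuous
    [psi] will be one of the functions that compute the integral of the larger
    function. *)
Lemma is_bounded_integral_le_RInt (f : pfun) (psi : R -> R) (h k v M eta e : R)
    (A : R -> Prop) :
  h <= k -> 0 <= M -> 0 <= eta -> is_bounded_integral f h k v -> dominated f h k M ->
  (forall x, continuous psi x) -> (forall x, segment h k x -> Rabs (psi x) <= M) ->
  thin e A ->
  (forall x, segment h k x -> ~ A x -> dom f x -> f x <= psi x + eta) ->
  v <= RInt psi h k + eta * (k - h) + 2 * M * e.
Proof.
  intros Hhk HM Heta (_ & _ & phi & Happ & Hlim) Hdf Hpsi HpsiM HA Hle.
  set (C := RInt psi h k + eta * (k - h) + 2 * M * e).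
  assert (H : Rbar_le v C); [|exact H].
  apply is_lim_seq_le with (3 := is_lim_seq_add_inv_INR _ _ (2 * M) (is_lim_seq_const C))
    (2 := Hlim).
  intros n.
  destruct (approximating_equal f h k phi n Happ) as (B & HB & Heq).
  assert (Hc := continuous_clamp h k (phi n) Hhk (approximating_continuous _ _ _ _ n Happ)).
  assert (Hint := RInt_minus_continuous _ psi h k Hc Hpsi).
  rewrite RInt_clamp in Hint by exact Hhk.
  assert (Hoff : RInt (fun x => phi n (clamp h k x) - psi x) h k
                 <= eta * (k - h) + 2 * M * (e + / INR (n + 1))).
  { apply RInt_le_off_thin with (fun x => A x \/ B x); [|exact Hhk|lra|exact Heta| | |].
    - intros x. apply (continuous_minus (fun y => phi n (clamp h k y)) psi);
        [apply Hc|apply Hpsi].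
    - intros x Hx. rewrite clamp_id by exact Hx.
      assert (H1 := approximating_bound f h k M phi Happ Hdf n x Hx).
      assert (H2 := HpsiM x Hx). apply Rabs_le_between in H1, H2. lra.
    - now apply thin_union.
    - intros x Hx HAB. rewrite clamp_id by exact Hx.
      destruct (Heq x Hx) as [Hdx ->]; [tauto|].
      assert (H1 : f x <= psi x + eta) by (apply Hle; [exact Hx|tauto|exact Hdx]). lra. }
  unfold C. lra.
Qed.

(** The comparison principle behind the uniqueness of the integral, its
    monotonicity and the passage to the limit: the two integrals are computed
    with continuous functions that satisfy the same inequality off a thin set. *)
Lemma is_bounded_integral_le (f g : pfun) (h k v w M eta e : R) (A : R -> Prop) :
  h <= k -> 0 <= M -> 0 <= eta ->
  is_bounded_integral f h k v -> is_bounded_integral g h k w ->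
  dominated f h k M -> dominated g h k M -> thin e A ->
  (forall x, segment h k x -> ~ A x -> dom f x -> dom g x -> f x <= g x + eta) ->
  v <= w + eta * (k - h) + 2 * M * e.
Proof.
  intros Hhk HM Heta Hf Hg Hdf Hdg HA Hle.
  destruct Hg as (_ & _ & phi & Happ & Hlim).
  set (C := eta * (k - h) + 2 * M * e).
  assert (H : Rbar_le (v - C) w); [|simpl in H; unfold C in H; lra].
  apply is_lim_seq_le with (2 := is_lim_seq_const (v - C))
    (3 := is_lim_seq_add_inv_INR _ _ (2 * M) Hlim).
  intros n.
  destruct (approximating_equal g h k phi n Happ) as (B & HB & Heq).
  assert (H : v <= RInt (fun x => phi n (clamp h k x)) h k + eta * (k - h)
                   + 2 * M * (e + / INR (n + 1))).
  { apply is_bounded_integral_le_RInt with f (fun x => A x \/ B x);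
      try assumption.
    - now apply continuous_clamp; [|apply approximating_continuous with g].
    - intros x Hx. rewrite clamp_id by exact Hx.
      now apply approximating_bound with g h k.
    - now apply thin_union.
    - intros x Hx HAB Hdx. rewrite clamp_id by exact Hx.
      destruct (Heq x Hx) as [Hgx ->]; [tauto|]. apply Hle; [exact Hx|tauto|exact Hdx|exact Hgx]. }
  rewrite RInt_clamp in H by exact Hhk. unfold C. lra.
Qed.

Lemma is_bounded_integral_dominated (f : pfun) (h k v : R) :
  is_bounded_integral f h k v -> exists M, 0 <= M /\ dominated f h k M.
Proof.
  intros ([M HM] & _). exists (Rmax M 0). split; [apply Rmax_r|].
  intros x Hx Hdx. apply Rle_trans with M; [now apply HM|apply Rmax_l].
Qed.

Lemma is_bounded_integral_unique (f : pfun) (h k v w : R) :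
  h <= k -> is_bounded_integral f h k v -> is_bounded_integral f h k w -> v = w.
Proof.
  intros Hhk Hv Hw. destruct (is_bounded_integral_dominated f h k v Hv) as (M & HM & HfM).
  assert (H0 : thin 0 (fun _ => False)) by (apply thin_empty; tauto).
  assert (H1 := is_bounded_integral_le f f h k v w M 0 0 _ Hhk HM (Rle_refl 0) Hv Hw
    HfM HfM H0).
  assert (H2 := is_bounded_integral_le f f h k w v M 0 0 _ Hhk HM (Rle_refl 0) Hw Hv
    HfM HfM H0).
  apply Rle_antisym; [specialize (H1 ltac:(intros; lra))|specialize (H2 ltac:(intros; lra))];
    lra.
Qed.

(** Intervals cannot cover a segment longer than their total length: otherwise the
    integral of the constant 1 would contradict [RInt_le_off_thin]. *)
Lemma outside_segment_nonempty (h k : R) (D : multiinterval) :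
  h < k -> Rbar_lt (mlength D) (k - h) -> exists x, outside (segment h k) D x.
Proof.
  intros Hhk HD. apply NNPP. intros Hno.
  assert (Hs : exists s, s < k - h /\ Rbar_lt (mlength D) s).
  { destruct (mlength D) as [l| |]; simpl in HD |- *.
    - exists ((l + (k - h)) / 2). lra.
    - contradiction.
    - exists 0. split; [lra|exact I]. }
  destruct Hs as (s & Hs & HDs).
  assert (H : RInt (fun _ => 1) h k <= 0 * (k - h) + 1 * s).
  { apply RInt_le_off_thin with (mcover D); try lra.
    - intros x. apply continuous_const.
    - intros x _. lra.
    - now apply thin_mcover.
    - intros x Hx Hc. elim Hno. now exists x. }
  rewrite RInt_constant in H. lra.
Qed.

(** The covers are also taken shorter than the segment, so that there are values
    of [f] to be extended. *)
Lemma approximating_exists (f : pfun) (h k : R) :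
  h < k -> bounded_on (segment h k) f -> quasicontinuous_on (segment h k) f ->
  exists phi, approximating f h k phi.
Proof.
  intros Hhk [M HM] [_ Hqc].
  assert (H : forall n, exists p : multiinterval * (R -> R),
    let S := outside (segment h k) (fst p) in
    Rbar_lt (mlength (fst p)) (/ INR (n + 1)) /\
    restr_continuous S f /\
    continuous_on (segment h k) (snd p) /\
    (forall x, S x -> snd p x = f x) /\
    Glb_Rbar (image (snd p) (segment h k)) = Glb_Rbar (image f S) /\
    Lub_Rbar (image (snd p) (segment h k)) = Lub_Rbar (image f S)).
  { intros n.
    assert (He : 0 < Rmin (/ INR (n + 1)) (k - h)).
    { apply Rmin_pos; [apply inv_INR_pos|lra]. }
    destruct (Hqc (mkposreal _ He)) as (D & HD & [Hdom Hcont]). simpl in HD.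
    destruct (outside_segment_nonempty h k D Hhk) as [s0 Hs0].
    { apply Rbar_lt_le_trans with (1 := HD). apply Rmin_r. }
    destruct (tietze (outside (segment h k) D) f M) as (phi & H1 & H2 & H3 & H4).
    - now exists s0.
    - apply outside_segment_closed.
    - exact Hcont.
    - intros s Ss. apply HM; [apply Ss|now apply Hdom].
    - exists (D, phi). cbn [fst snd]. split; [|split; [|split; [|split; [|split]]]].
      + apply Rbar_lt_le_trans with (1 := HD). apply Rmin_l.
      + now split.
      + apply continuous_on_forall. intros x _. apply H1.
      + exact H2.
      + apply Rbar_le_antisym.
        * apply Glb_Rbar_correct. intros y (s & Ss & ->).
          rewrite <- (H2 s Ss). apply Glb_Rbar_correct. exists s. now split; [apply Ss|].
        * apply Glb_Rbar_correct. intros y (x & Hx & ->).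
          assert (Hlow : forall s, outside (segment h k) D s ->
                    Rbar_le (Glb_Rbar (image f (outside (segment h k) D))) (f s)).
          { intros s Ss. apply Glb_Rbar_correct. now exists s. }
          destruct (Glb_Rbar _) as [a| |].
          -- simpl. now apply H3.
          -- elim (Hlow s0 Hs0).
          -- exact I.
      + apply Rbar_le_antisym.
        * apply Lub_Rbar_correct. intros y (x & Hx & ->).
          assert (Hupp : forall s, outside (segment h k) D s ->
                    Rbar_le (f s) (Lub_Rbar (image f (outside (segment h k) D)))).
          { intros s Ss. apply Lub_Rbar_correct. now exists s. }
          destruct (Lub_Rbar _) as [a| |].
          -- simpl. now apply H4.
          -- exact I.
          -- elim (Hupp s0 Hs0).
        * apply Lub_Rbar_correct. intros y (s & Ss & ->).
          rewrite <- (H2 s Ss). apply Lub_Rbar_correct. exists s. now split; [apply Ss|]. }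
  destruct (choice _ H) as [p Hp].
  exists (fun n => snd (p n)), (fun n => fst (p n)). exact Hp.
Qed.

Lemma approximating_RInt_cauchy (f : pfun) (h k M : R) (phi : nat -> R -> R) (n m : nat) :
  h <= k -> 0 <= M -> approximating f h k phi -> dominated f h k M ->
  RInt (phi n) h k - RInt (phi m) h k <= 2 * M * (/ INR (n + 1) + / INR (m + 1)).
Proof.
  intros Hhk HM Happ HfM.
  assert (Hc : forall i x, continuous (fun y => phi i (clamp h k y)) x).
  { intros i. apply continuous_clamp; [exact Hhk|]. now apply approximating_continuous with f. }
  assert (Hint := RInt_minus_continuous _ _ h k (Hc n) (Hc m)).
  rewrite !RInt_clamp in Hint by exact Hhk. rewrite <- Hint.
  destruct (approximating_equal f h k phi n Happ) as (A & HA & HAe).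
  destruct (approximating_equal f h k phi m Happ) as (B & HB & HBe).
  apply Rle_trans with (0 * (k - h) + 2 * M * (/ INR (n + 1) + / INR (m + 1))); [|lra].
  apply RInt_le_off_thin with (fun x => A x \/ B x); try lra.
  - intros x. apply (continuous_minus (fun y => phi n (clamp h k y))
      (fun y => phi m (clamp h k y))); apply Hc.
  - intros x Hx. rewrite clamp_id by exact Hx.
    assert (H1 := approximating_bound f h k M phi Happ HfM n x Hx).
    assert (H2 := approximating_bound f h k M phi Happ HfM m x Hx).
    apply Rabs_le_between in H1, H2. lra.
  - now apply thin_union.
  - intros x Hx HAB. rewrite clamp_id by exact Hx.
    rewrite (proj2 (HAe x Hx ltac:(tauto))), (proj2 (HBe x Hx ltac:(tauto))). lra.
Qed.

Lemma is_bounded_integral_exists (f : pfun) (h k : R) :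
  h < k -> bounded_on (segment h k) f -> quasicontinuous_on (segment h k) f ->
  exists v, is_bounded_integral f h k v.
Proof.
  intros Hhk Hb Hqc.
  destruct (approximating_exists f h k Hhk Hb Hqc) as [phi Happ].
  assert (HM : exists M, 0 <= M /\ dominated f h k M).
  { destruct Hb as [M HM]. exists (Rmax M 0). split; [apply Rmax_r|].
    intros x Hx Hdx. apply Rle_trans with M; [now apply HM|apply Rmax_l]. }
  destruct HM as (M & HM & HfM).
  assert (Hcau := fun n m => approximating_RInt_cauchy f h k M phi n m
    (Rlt_le _ _ Hhk) HM Happ HfM).
  assert (Hex : ex_finite_lim_seq (fun n => RInt (phi n) h k)).
  { apply ex_lim_seq_cauchy_corr. intros eps.
    assert (He : 0 < eps / (4 * M + 1)) by (apply Rdiv_lt_0_compat; [apply cond_pos|lra]).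
    assert (Ee : eps / (4 * M + 1) * (4 * M + 1) = eps) by (field; lra).
    destruct (proj2 (is_lim_seq_spec _ _) is_lim_seq_inv_INR (mkposreal _ He)) as [N HN].
    exists N. intros n m Hn Hm.
    assert (H1 := HN n Hn). assert (H2 := HN m Hm). simpl in H1, H2.
    apply Rabs_def2 in H1, H2.
    assert (H3 := Hcau n m). assert (H4 := Hcau m n).
    apply Rabs_def1; nra. }
  destruct Hex as [v Hv]. exists v. split; [exact Hb|split; [exact Hqc|]].
  now exists phi.
Qed.

Lemma bounded_integral_correct (f : pfun) (h k : R) :
  h < k -> bounded_on (segment h k) f -> quasicontinuous_on (segment h k) f ->
  is_bounded_integral f h k (bounded_integral f h k).
Proof.
  intros Hhk Hb Hqc.
  destruct (is_bounded_integral_exists f h k Hhk Hb Hqc) as [v Hv].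
  apply (iota_correct (is_bounded_integral f h k)). exists v. split; [exact Hv|].
  intros w Hw. apply is_bounded_integral_unique with f h k; [lra|exact Hv|exact Hw].
Qed.

(** * Superlevel sets of increasing sequences of continuous functions *)

(** The pieces of length [(v - u) / 2 ^ d] in the dyadic decomposition of the part
    of [O] between [u] and [v]: the interval is halved until a piece lies in [O].
    Grading by the depth makes every list finite even if the decomposition is
    infinite. *)
Fixpoint pieces (O : R -> Prop) (d : nat) (u v : R) : list (R * R) :=
  if excluded_middle_informative (forall x, u <= x <= v -> O x)
  then match d with O => (u, v) :: nil | _ => nil end
  else match d with
       | O => nil
       | S d => pieces O d u ((u + v) / 2) ++ pieces O d ((u + v) / 2) v
       end.

Definition length_sum (l : list (R * R)) : R := list_sum (fun I => snd I - fst I) l.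

Lemma pieces_ordered (O : R -> Prop) (d : nat) (u v : R) (I : R * R) :
  u <= v -> In I (pieces O d u v) -> fst I <= snd I.
Proof.
  revert u v. induction d as [|d IH]; intros u v Huv; simpl;
    destruct (excluded_middle_informative _) as [Hin|Hin]; simpl; try tauto.
  - intros [<-|[]]. exact Huv.
  - intros HI. apply in_app_iff in HI. destruct HI as [HI|HI]; eapply IH; try exact HI; lra.
Qed.

Lemma pieces_cover (O : R -> Prop) (x r : R) (d : nat) (u v : R) :
  (forall y, Rabs (y - x) < r -> O y) -> u <= x <= v -> v - u < r * 2 ^ d ->
  exists d' I, In I (pieces O d' u v) /\ fst I <= x <= snd I.
Proof.
  intros HO. revert u v. induction d as [|d IH]; intros u v Hx Hr.
  - exists 0%nat, (u, v). split; [|exact Hx]. simpl.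
    destruct (excluded_middle_informative _) as [Hin|Hin]; [now left|].
    elim Hin. intros y Hy. apply HO. simpl in Hr. apply Rabs_def1; lra.
  - destruct (excluded_middle_informative (forall y, u <= y <= v -> O y)) as [Hin|Hin].
    { exists 0%nat, (u, v). split; [|exact Hx]. simpl.
      destruct (excluded_middle_informative _) as [_|Hin']; [now left|contradiction]. }
    simpl in Hr.
    destruct (Rle_lt_dec x ((u + v) / 2)) as [Hw|Hw].
    + destruct (IH u ((u + v) / 2)) as (d' & I & HI & HxI); [lra|lra|].
      exists (S d'), I. split; [|exact HxI]. simpl.
      destruct (excluded_middle_informative _) as [Hin'|_]; [contradiction|].
      apply in_app_iff. now left.
    + destruct (IH ((u + v) / 2) v) as (d' & I & HI & HxI); [lra|lra|].
      exists (S d'), I. split; [|exact HxI]. simpl.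
      destruct (excluded_middle_informative _) as [Hin'|_]; [contradiction|].
      apply in_app_iff. now right.
Qed.

Lemma thin_list (l : list (R * R)) :
  (forall I, In I l -> fst I <= snd I) ->
  thin (length_sum l) (fun x => exists I, In I l /\ fst I <= x <= snd I).
Proof.
  induction l as [|J l IH]; intros Hl.
  - apply thin_empty. intros x (I & [] & _).
  - unfold length_sum. simpl.
    apply thin_subset with (snd J - fst J + length_sum l)
      (fun x => fst J <= x <= snd J \/ exists I, In I l /\ fst I <= x <= snd I).
    + apply thin_union.
      * apply thin_segment, Hl. now left.
      * apply IH. intros I HI. apply Hl. now right.
    + apply Rle_refl.
    + intros x (I & [<-|HI] & Hx); [now left|]. right. now exists I.
Qed.

Lemma sum_n_shift (a : nat -> R) (N : nat) :
  sum_n a (S N) = a 0%nat + sum_n (fun n => a (S n)) N :> R.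
Proof.
  induction N as [|N IH].
  - rewrite sum_n_succ, !sum_n_zero. reflexivity.
  - rewrite sum_n_succ, IH, (sum_n_succ (fun n => a (S n))). ring.
Qed.

Lemma increasing_le (a : nat -> R) (n m : nat) :
  (forall i, a i <= a (S i)) -> (n <= m)%nat -> a n <= a m.
Proof.
  intros H Hnm. induction Hnm as [|m Hnm IH]; [lra|]. specialize (H m). lra.
Qed.

Lemma RInt_increasing (g : nat -> R -> R) (n m : nat) (u v : R) :
  (forall m x, continuous (g m) x) -> (forall m x, g m x <= g (S m) x) ->
  u <= v -> (n <= m)%nat -> RInt (g n) u v <= RInt (g m) u v.
Proof.
  intros Hg Hmon Huv Hnm. apply RInt_le_continuous; [apply Hg|apply Hg|exact Huv|].
  intros x. now apply (increasing_le (fun m => g m x)).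
Qed.

(** By compactness, monotonicity makes one index serve for all points. *)
Lemma superlevel_segment (g : nat -> R -> R) (c u v : R) :
  (forall m x, continuous (g m) x) -> (forall m x, g m x <= g (S m) x) -> u <= v ->
  (forall x, u <= x <= v -> exists m, c < g m x) ->
  exists m, c * (v - u) <= RInt (g m) u v.
Proof.
  intros Hg Hmon Huv Hc.
  apply (cousin (fun s t => exists m, c * (t - s) <= RInt (g m) s t)); [exact Huv| |].
  - intros s w t Hs Ht [m1 H1] [m2 H2]. exists (max m1 m2).
    rewrite (RInt_split _ s w t (Hg _)).
    assert (H3 : RInt (g m1) s w <= RInt (g (max m1 m2)) s w).
    { apply RInt_increasing; [exact Hg|exact Hmon|lra|lia]. }
    assert (H4 : RInt (g m2) w t <= RInt (g (max m1 m2)) w t).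
    { apply RInt_increasing; [exact Hg|exact Hmon|lra|lia]. }
    lra.
  - intros x Hx. destruct (Hc x Hx) as [m Hm].
    destruct (proj1 (continuous_eps (g m) x) (Hg m x) (g m x - c)) as (d & Hd & Hd'); [lra|].
    exists d. split; [exact Hd|]. intros s t Hs Ht Hs' Ht'. exists m.
    apply RInt_const_le; [apply Hg|lra|]. intros y Hy.
    assert (H : Rabs (g m y - g m x) < g m x - c) by (apply Hd'; apply Rabs_def1; lra).
    apply Rabs_def2 in H. lra.
Qed.

(** The pieces do not overlap, so that their lengths add up to at most the
    integral; this appears here as the additivity of both sides under halving. *)
Lemma pieces_length_le_RInt (g : nat -> R -> R) (c : R) (N : nat) (u v : R) :
  (forall m x, continuous (g m) x) -> (forall m x, g m x <= g (S m) x) ->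
  (forall m x, 0 <= g m x) -> u <= v ->
  exists m, c * sum_n (fun d => length_sum (pieces (fun x => exists m, c < g m x) d u v)) N
            <= RInt (g m) u v.
Proof.
  intros Hg Hmon Hpos. set (O := fun x => exists m, c < g m x).
  revert u v. induction N as [|N IH]; intros u v Huv;
    destruct (excluded_middle_informative (forall x, u <= x <= v -> O x)) as [Hin|Hin].
  - destruct (superlevel_segment g c u v Hg Hmon Huv Hin) as [m Hm]. exists m.
    rewrite sum_n_zero. simpl.
    destruct (excluded_middle_informative _) as [_|Hin']; [|contradiction].
    unfold length_sum. simpl. lra.
  - exists 0%nat. rewrite sum_n_zero. simpl.
    destruct (excluded_middle_informative _) as [Hin'|_]; [contradiction|].
    unfold length_sum. simpl.
    assert (H := RInt_const_le (g 0%nat) u v 0 (Hg _) Huv (fun x _ => Hpos 0%nat x)). lra.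
  - destruct (superlevel_segment g c u v Hg Hmon Huv Hin) as [m Hm]. exists m.
    rewrite sum_n_shift.
    rewrite (sum_n_ext _ (fun _ => 0)).
    2:{ intros d. simpl. destruct (excluded_middle_informative _) as [_|Hin'];
          [reflexivity|contradiction]. }
    rewrite sum_n_const. simpl.
    destruct (excluded_middle_informative _) as [_|Hin']; [|contradiction].
    unfold length_sum. simpl. lra.
  - set (w := (u + v) / 2).
    destruct (IH u w) as [m1 H1]; [unfold w; lra|].
    destruct (IH w v) as [m2 H2]; [unfold w; lra|].
    exists (max m1 m2). rewrite (RInt_split _ u w v (Hg _)).
    rewrite sum_n_shift.
    rewrite (sum_n_ext _ (fun d => length_sum (pieces O d u w) + length_sum (pieces O d w v))).
    2:{ intros d. simpl. destruct (excluded_middle_informative _) as [Hin'|_];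
          [contradiction|]. apply list_sum_app. }
    rewrite sum_n_add.
    assert (E : length_sum (pieces O 0 u v) = 0).
    { simpl. destruct (excluded_middle_informative _) as [Hin'|_];
        [contradiction|reflexivity]. }
    rewrite E.
    assert (H3 : RInt (g m1) u w <= RInt (g (max m1 m2)) u w).
    { apply RInt_increasing; [exact Hg|exact Hmon|unfold w; lra|lia]. }
    assert (H4 : RInt (g m2) w v <= RInt (g (max m1 m2)) w v).
    { apply RInt_increasing; [exact Hg|exact Hmon|unfold w; lra|lia]. }
    lra.
Qed.

(** Chebyshev's inequality for the supremum of the sequence.  The superlevel set
    is open, hence a countable union of dyadic pieces, and the lengths of finitely
    many pieces are controlled by the integral of a single member. *)
Lemma thin_superlevel (g : nat -> R -> R) (c e u v : R) :
  (forall m x, continuous (g m) x) -> (forall m x, g m x <= g (S m) x) ->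
  (forall m x, 0 <= g m x) -> u <= v -> 0 < c ->
  (forall m, RInt (g m) u v <= c * e) ->
  thin e (fun x => u <= x <= v /\ exists m, c < g m x).
Proof.
  intros Hg Hmon Hpos Huv Hc Hint. set (O := fun x => exists m, c < g m x).
  apply thin_subset with e
    (fun x => exists d, exists I, In I (pieces O d u v) /\ fst I <= x <= snd I).
  - apply thin_countable_union with (fun d => length_sum (pieces O d u v)).
    + intros d. apply thin_list. intros I. now apply pieces_ordered.
    + intros N. destruct (pieces_length_le_RInt g c N u v Hg Hmon Hpos Huv) as [m Hm].
      specialize (Hint m). apply Rmult_le_reg_l with c; [exact Hc|].
      fold O in Hm. lra.
  - lra.
  - intros x (Hx & m & Hm).
    destruct (proj1 (continuous_eps (g m) x) (Hg m x) (g m x - c)) as (r & Hr & Hr'); [lra|].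
    (* a depth at which the pieces are shorter than [r] *)
    destruct (Pow_x_infinity 2) with (b := (v - u) / r + 1) as [d Hd].
    { rewrite Rabs_right; lra. }
    apply pieces_cover with r d; [|exact Hx|].
    + intros y Hy. exists m. specialize (Hr' y Hy). apply Rabs_def2 in Hr'. lra.
    + specialize (Hd d (Nat.le_refl d)).
      rewrite Rabs_right in Hd by (apply Rle_ge, pow_le; lra).
      assert (E : (v - u) / r * r = v - u) by (field; lra). nra.
Qed.

(** * Increasing limits of quasicontinuous functions *)

Definition increases_to (fn : nat -> pfun) (f : pfun) (x : R) : Prop :=
  (forall n, dom (fn n) x) /\ dom f x /\
  (forall n, 0 <= fn n x <= fn (S n) x) /\
  is_lim_seq (fun n => fn n x) (f x).

Lemma increases_to_le (fn : nat -> pfun) (f : pfun) (x : R) (n m : nat) :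
  increases_to fn f x -> (n <= m)%nat -> fn n x <= fn m x.
Proof.
  intros (_ & _ & H & _) Hnm. apply (increasing_le (fun i => fn i x)); [|exact Hnm].
  intros i. apply H.
Qed.

Lemma increases_to_le_limit (fn : nat -> pfun) (f : pfun) (x : R) (n : nat) :
  increases_to fn f x -> fn n x <= f x.
Proof.
  intros (_ & _ & H & Hl). apply (is_lim_seq_incr_compare (fun i => fn i x)); [exact Hl|].
  intros i. apply H.
Qed.

(** The exceptional sets of the [fn n] and of [P] are countably many, hence can be
    covered together. *)
Lemma common_continuity (fn : nat -> pfun) (P : R -> Prop) (e : R) :
  (forall n, quasicontinuous_on line (fn n)) -> ae P -> 0 < e ->
  exists D, Rbar_lt (mlength D) e /\
    (forall x, ~ mcover D x -> P x) /\
    (forall n, continuous_on (outside line D) (fn n)).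
Proof.
  intros Hqc HP He.
  assert (H : forall n, exists D : multiinterval,
    Rbar_lt (mlength D) (e / 4 * (/ 2) ^ S n) /\ restr_continuous (outside line D) (fn n)).
  { intros n. assert (Hp := half_pow_pos (S n)).
    assert (He' : 0 < e / 4 * (/ 2) ^ S n) by nra.
    exact (proj2 (Hqc n) (mkposreal _ He')). }
  destruct (choice _ H) as [Dn HDn].
  assert (H1 : thin (e / 4) (fun x => exists n, mcover (Dn n) x)).
  { apply thin_countable_union_halves; [lra|]. intros n. apply thin_mcover, HDn. }
  assert (H2 : thin (e / 4) (fun x => ~ P x)) by (apply null_set_thin; [exact HP|lra]).
  destruct (thin_multiinterval _ e _ (thin_union _ _ _ _ H1 H2)) as (D & HD & Hcov); [lra|].
  exists D. split; [exact HD|split].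
  - intros x Hx. apply NNPP. intros HPx. apply Hx, Hcov. now right.
  - intros n. apply continuous_on_subset with (outside line (Dn n)).
    + intros x [_ Hx]. split; [exact I|]. intros Hc. apply Hx, Hcov. left. now exists n.
    + apply HDn.
Qed.

(** Continuous extensions of the members of an increasing sequence increase only
    where they agree with the members; running maxima restore the monotonicity
    without changing the values there. *)
Fixpoint running_max (phi : nat -> R -> R) (n : nat) (x : R) : R :=
  match n with
  | O => phi 0%nat x
  | S n => Rmax (running_max phi n x) (phi (S n) x)
  end.

Lemma continuous_Rmax (f g : R -> R) (x : R) :
  continuous f x -> continuous g x -> continuous (fun y => Rmax (f y) (g y)) x.
Proof.
  intros Hf Hg. apply continuous_eps. intros e He.
  destruct (proj1 (continuous_eps f x) Hf e He) as (d1 & Hd1 & H1).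
  destruct (proj1 (continuous_eps g x) Hg e He) as (d2 & Hd2 & H2).
  exists (Rmin d1 d2). split; [now apply Rmin_pos|]. intros y Hy.
  assert (H3 := H1 y (Rlt_le_trans _ _ _ Hy (Rmin_l _ _))).
  assert (H4 := H2 y (Rlt_le_trans _ _ _ Hy (Rmin_r _ _))).
  apply Rabs_def2 in H3, H4. apply Rabs_def1; unfold Rmax; repeat destruct (Rle_dec _ _); lra.
Qed.

Lemma continuous_running_max (phi : nat -> R -> R) (n : nat) (x : R) :
  (forall n x, continuous (phi n) x) -> continuous (running_max phi n) x.
Proof.
  intros H. induction n as [|n IH]; [apply H|].
  apply (continuous_Rmax (running_max phi n) (phi (S n))); [exact IH|apply H].
Qed.

Lemma running_max_le (phi : nat -> R -> R) (B : R) (n : nat) (x : R) :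
  (forall n, phi n x <= B) -> running_max phi n x <= B.
Proof.
  intros H. induction n as [|n IH]; simpl; [apply H|]. apply Rmax_lub; [exact IH|apply H].
Qed.

Lemma running_max_increasing (phi : nat -> R -> R) (n : nat) (x : R) :
  (forall n, phi n x <= phi (S n) x) -> running_max phi n x = phi n x.
Proof.
  intros H. induction n as [|n IH]; simpl; [reflexivity|]. rewrite IH. now apply Rmax_right.
Qed.

(** Egorov's theorem for increasing sequences.  The function [theta] serves to
    bound the sequence: the integrals of continuous extensions of the
    [theta (fn n x)] then form a bounded increasing sequence of reals, so that
    they eventually change very little, and Chebyshev's inequality shows that
    the functions themselves change little off a thin set. *)
Lemma almost_uniform_convergence (fn : nat -> pfun) (f : pfun) (theta : R -> R)
    (B u v c e : R) :
  (forall n, quasicontinuous_on line (fn n)) -> ae (increases_to fn f) ->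
  u <= v -> 0 < c -> 0 < e ->
  (forall y, continuous theta y) -> (forall y z, y <= z -> theta y <= theta z) ->
  (forall y, Rabs (theta y) <= B) ->
  exists n A, thin e A /\ forall x, u <= x <= v -> ~ A x ->
    increases_to fn f x /\
    forall m, (n <= m)%nat -> theta (f x) <= theta (fn m x) + c.
Proof.
  intros Hqc Hae Huv Hc He Hth Hmon HB.
  destruct (common_continuity fn _ (e / 2) Hqc Hae) as (D & HD & Hgood & Hcont); [lra|].
  set (S := outside (segment u v) D).
  destruct (classic (exists s, S s)) as [HS|HS].
  2:{ exists 0%nat, (mcover D). split.
      - apply thin_mcover. apply Rbar_lt_le_trans with (1 := HD). simpl. lra.
      - intros x Hx HDx. elim HS. now exists x. }
  assert (Hext : forall n, exists phi : R -> R, (forall x, continuous phi x) /\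
    (forall s, S s -> phi s = theta (fn n s)) /\ (forall x, - B <= phi x <= B)).
  { intros n.
    destruct (tietze S (fun x => theta (fn n x)) B HS) as (phi & H1 & H2 & H3 & H4).
    - apply outside_segment_closed.
    - intros x Sx. apply (filterlim_comp _ _ _ (fn n) theta _ (locally (fn n x))).
      + apply (continuous_on_subset _ S (fn n)) with (2 := Hcont n); [|exact Sx].
        intros y [_ Hy]. now split.
      + apply Hth.
    - intros s _. apply HB.
    - exists phi. split; [exact H1|split; [exact H2|]]. intros x. split.
      + apply H3. intros s _. apply (Rabs_le_between _ B), HB.
      + apply H4. intros s _. apply (Rabs_le_between _ B), HB. }
  destruct (choice _ Hext) as [phi Hphi].
  set (Phi := running_max phi).
  assert (Phi_cont : forall n x, continuous (Phi n) x).
  { intros n x. apply continuous_running_max. intros m. apply Hphi. }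
  assert (Phi_incr : forall n x, Phi n x <= Phi (Datatypes.S n) x)
    by (intros n x; apply Rmax_l).
  assert (Phi_eq : forall n x, S x -> Phi n x = theta (fn n x)).
  { intros n x Sx. unfold Phi. rewrite running_max_increasing; [now apply Hphi|].
    intros m. rewrite !(proj1 (proj2 (Hphi _)) x Sx). apply Hmon.
    apply (increases_to_le fn f); [apply Hgood, Sx|lia]. }
  assert (Hint_incr : forall n, RInt (Phi n) u v <= RInt (Phi (Datatypes.S n)) u v).
  { intros n. apply RInt_le_continuous; [apply Phi_cont|apply Phi_cont|exact Huv|].
    apply Phi_incr. }
  destruct (ex_finite_lim_seq_incr (fun n => RInt (Phi n) u v) (B * (v - u)))
    as [l Hl]; [exact Hint_incr| |].
  { intros n. apply RInt_le_const; [apply Phi_cont|exact Huv|]. intros x _.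
    apply running_max_le. intros m. apply Hphi. }
  assert (Hce : 0 < c * (e / 2)) by nra.
  destruct (proj2 (is_lim_seq_spec _ _) Hl (mkposreal _ Hce)) as [n Hn].
  specialize (Hn n (Nat.le_refl n)). simpl in Hn. apply Rabs_def2 in Hn.
  (* [g] has integrals below [c * (e / 2)] by the choice of [n] *)
  set (g := fun m x => Phi (n + m)%nat x - Phi n x).
  exists n, (fun x => mcover D x \/ (u <= x <= v /\ exists m, c < g m x)). split.
  - replace e with (e / 2 + e / 2) by field.
    apply thin_union; [now apply thin_mcover|].
    apply thin_superlevel; [| | |exact Huv|exact Hc|].
    + intros m x. apply (continuous_minus (Phi (n + m)%nat) (Phi n)); apply Phi_cont.
    + intros m x. unfold g. rewrite Nat.add_succ_r.
      assert (H := Phi_incr (n + m)%nat x). lra.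
    + intros m x. unfold g.
      assert (H := increasing_le (fun i => Phi i x) n (n + m) (fun i => Phi_incr i x)
        (Nat.le_add_r n m)). simpl in H. lra.
    + intros m. unfold g. rewrite (RInt_minus_continuous (Phi (n + m)%nat) (Phi n))
        by apply Phi_cont.
      assert (H := is_lim_seq_incr_compare _ l Hl Hint_incr (n + m)). simpl in H. lra.
  - intros x Hx HA.
    assert (Sx : S x) by (split; [exact Hx|tauto]).
    assert (Hg := Hgood x (proj2 Sx)). split; [exact Hg|].
    assert (Hbound : forall m, theta (fn (n + m)%nat x) <= theta (fn n x) + c).
    { intros m. apply Rnot_lt_le. intros Hlt. apply HA. right. split; [exact Hx|].
      exists m. unfold g. rewrite !Phi_eq by exact Sx. lra. }
    assert (Hlim : is_lim_seq (fun m => theta (fn m x)) (theta (f x))).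
    { apply (is_lim_seq_continuous theta (fun m => fn m x)); [|apply Hg].
      apply continuity_pt_filterlim, Hth. }
    assert (Hle : Rbar_le (theta (f x)) (theta (fn n x) + c)).
    { apply is_lim_seq_le_loc with (2 := Hlim) (3 := is_lim_seq_const _).
      exists n. intros m Hm. replace m with (n + (m - n))%nat by lia. apply Hbound. }
    simpl in Hle. intros m Hm.
    assert (H := Hmon _ _ (increases_to_le fn f x n m Hg Hm)). lra.
Qed.

Lemma continuous_on_of_atan (S : R -> Prop) (f : R -> R) :
  continuous_on S (fun x => atan (f x)) -> continuous_on S f.
Proof.
  intros H x Sx.
  apply filterlim_ext with (fun y => tan (atan (f y))).
  { intros y. apply tan_atan. }
  replace (f x) with (tan (atan (f x))) by apply tan_atan.
  apply (filterlim_comp _ _ _ (fun y => atan (f y)) tan _ (locally (atan (f x)))).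
  - now apply H.
  - apply continuous_tan. assert (Hb := atan_bound (f x)).
    assert (Hcos : 0 < cos (atan (f x))) by (apply cos_gt_0; lra). lra.
Qed.

(** Off a small set, [atan f] is uniformly close to some [atan (fn n)] on every
    bounded interval, hence continuous.  The arctangent bounds the sequence as
    [almost_uniform_convergence] requires, and it can be inverted. *)
Lemma limit_quasicontinuous (fn : nat -> pfun) (f : pfun) :
  (forall n, quasicontinuous_on line (fn n)) -> ae (increases_to fn f) ->
  quasicontinuous_on line f.
Proof.
  intros Hqc Hae. split.
  { intros eps. destruct (Hae eps) as (D & HD & Hc). exists D. split; [exact HD|].
    intros x [_ Hx]. apply Hc. intros (_ & Hdx & _). contradiction. }
  intros [eps Heps]. simpl.
  destruct (common_continuity fn _ (eps / 4) Hqc Hae) as (D0 & HD0 & Hgood & Hcont); [lra|].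
  assert (H : forall j, exists nA : nat * (R -> Prop),
    thin (eps / 4 * (/ 2) ^ S j) (snd nA) /\
    forall x, - INR j <= x <= INR j -> ~ snd nA x ->
      atan (f x) <= atan (fn (fst nA) x) + / INR (j + 1)).
  { intros j.
    destruct (almost_uniform_convergence fn f atan (PI / 2) (- INR j) (INR j)
      (/ INR (j + 1)) (eps / 4 * (/ 2) ^ S j) Hqc Hae) as (n & A & HA & H).
    - assert (H := pos_INR j). lra.
    - apply inv_INR_pos.
    - assert (H := half_pow_pos (S j)). nra.
    - apply continuous_atan.
    - intros y z [Hyz| ->]; [left; now apply atan_increasing|lra].
    - intros y. assert (Hb := atan_bound y). apply Rabs_le_between. lra.
    - exists (n, A). split; [exact HA|]. intros x Hx HAx.
      apply (proj2 (H x Hx HAx)). apply Nat.le_refl. }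
  destruct (choice _ H) as [nA HnA].
  assert (H1 : thin (eps / 4) (fun x => exists j, snd (nA j) x)).
  { apply thin_countable_union_halves; [lra|]. intros j. apply HnA. }
  destruct (thin_multiinterval _ eps _ (thin_union _ _ _ _ (thin_mcover _ _ HD0) H1))
    as (D & HD & Hcov); [lra|].
  assert (Hgood' : forall x, outside line D x -> increases_to fn f x).
  { intros x [_ Hx]. apply Hgood. intros Hc. apply Hx, Hcov. now left. }
  exists D. split; [exact HD|]. split.
  { intros x Hx. apply (Hgood' x Hx). }
  apply continuous_on_of_atan, continuous_on_eps. intros x Hx e He.
  destruct (INR_unbounded (Rmax (Rabs x + 1) (3 / e))) as [j Hj].
  assert (Hj1 := Rle_lt_trans _ _ _ (Rmax_l _ _) Hj).
  assert (Hj2 := Rle_lt_trans _ _ _ (Rmax_r _ _) Hj).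
  assert (Hje : / INR (j + 1) < e / 3).
  { replace (e / 3) with (/ (3 / e)) by (field; lra).
    assert (H3e : 0 < 3 / e) by (apply Rdiv_lt_0_compat; lra).
    apply Rinv_lt_contravar; rewrite plus_INR; simpl; nra. }
  set (n := fst (nA j)).
  assert (Hclose : forall y, outside line D y -> Rabs y <= INR j ->
            atan (fn n y) <= atan (f y) <= atan (fn n y) + / INR (j + 1)).
  { intros y Hy Hyj. split.
    - destruct (increases_to_le_limit fn f y n (Hgood' y Hy)) as [Hlt| ->]; [|lra].
      left. now apply atan_increasing.
    - apply HnA; [now apply Rabs_le_between|]. intros HAy. apply Hy, Hcov. right.
      now exists j. }
  assert (Hfn : continuous_on (outside line D) (fun y => atan (fn n y))).
  { intros y Hy. apply (filterlim_comp _ _ _ (fn n) atan _ (locally (fn n y))).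
    - apply (continuous_on_subset (outside line D0) (outside line D) (fn n))
        with (2 := Hcont n); [|exact Hy].
      intros z [_ Hz]. split; [exact I|]. intros Hc. apply Hz, Hcov. now left.
    - apply continuous_atan. }
  destruct (proj1 (continuous_on_eps _ _) Hfn x Hx (e / 3)) as (d & Hd & Hd'); [lra|].
  exists (Rmin d 1). split; [apply Rmin_pos; lra|]. intros y Hy Hyx.
  assert (Hyd := Rlt_le_trans _ _ _ Hyx (Rmin_l _ _)).
  assert (Hy1 := Rlt_le_trans _ _ _ Hyx (Rmin_r _ _)).
  assert (Hyj : Rabs y <= INR j).
  { assert (Ht := Rabs_triang x (y - x)). replace (x + (y - x)) with y in Ht by ring. lra. }
  assert (H2 := Hclose x Hx ltac:(lra)). assert (H3 := Hclose y Hy Hyj).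
  assert (H4 := Hd' y Hy Hyd). apply Rabs_def2 in H4.
  apply Rabs_def1; lra.
Qed.

(** * Truncated integrals and their suprema *)

Lemma continuous_Rmax_r (c x : R) : continuous (fun y => Rmax y c) x.
Proof.
  apply Lipschitz_continuous with 1; [lra|]. intros y z.
  unfold Rmax, Rabs. repeat destruct (Rle_dec _ _); destruct (Rcase_abs _); lra.
Qed.

Lemma continuous_Rmin_r (c x : R) : continuous (fun y => Rmin y c) x.
Proof.
  apply Lipschitz_continuous with 1; [lra|]. intros y z.
  unfold Rmin, Rabs. repeat destruct (Rle_dec _ _); destruct (Rcase_abs _); lra.
Qed.

Lemma quasicontinuous_pmap (S : R -> Prop) (g : R -> R) (f : pfun) :
  (forall y, continuous g y) -> quasicontinuous_on S f -> quasicontinuous_on S (pmap g f).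
Proof.
  intros Hg [Hdef Hqc]. split; [exact Hdef|].
  intros eps. destruct (Hqc eps) as (D & HD & [Hdom Hcont]). exists D.
  split; [exact HD|split; [exact Hdom|]].
  intros x Hx. apply (filterlim_comp _ _ _ f g _ (locally (f x))); [now apply Hcont|apply Hg].
Qed.

Lemma quasicontinuous_segment (h k : R) (f : pfun) :
  quasicontinuous_on line f -> quasicontinuous_on (segment h k) f.
Proof.
  intros [Hdef Hqc]. split.
  - intros eps. destruct (Hdef eps) as (D & HD & Hc). exists D. split; [exact HD|].
    intros x [_ Hx]. apply Hc. now split.
  - intros eps. destruct (Hqc eps) as (D & HD & [Hdom Hcont]). exists D.
    split; [exact HD|].
    assert (Hsub : forall x, outside (segment h k) D x -> outside line D x)
      by (intros x [_ Hx]; now split).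
    split.
    + intros x Hx. apply Hdom, Hsub, Hx.
    + now apply (continuous_on_subset (outside line D)).
Qed.

Definition truncation (f : pfun) (N : R) : pfun := pmap (fun y => Rmin y N) (pos_part f).

Definition truncated_integral (f : pfun) (rho N : R) : R :=
  bounded_integral (truncation f N) (- rho) rho.

Lemma truncation_between (f : pfun) (N x : R) : 0 <= N -> 0 <= truncation f N x <= N.
Proof.
  intros HN. simpl. unfold Rmin, Rmax. repeat destruct (Rle_dec _ _); lra.
Qed.

Lemma truncation_dominated (f : pfun) (h k N N' : R) :
  0 <= N -> N <= N' -> dominated (truncation f N) h k N'.
Proof.
  intros HN HN' x _ _. assert (H := truncation_between f N x HN).
  apply Rabs_le_between. lra.
Qed.

Lemma truncated_integral_correct (f : pfun) (rho N : R) :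
  quasicontinuous_on line f -> 0 < rho -> 0 <= N ->
  is_bounded_integral (truncation f N) (- rho) rho (truncated_integral f rho N).
Proof.
  intros Hf Hrho HN. apply bounded_integral_correct; [lra| |].
  - exists N. apply truncation_dominated; [exact HN|apply Rle_refl].
  - apply quasicontinuous_segment.
    apply quasicontinuous_pmap; [apply continuous_Rmin_r|].
    apply quasicontinuous_pmap; [apply continuous_Rmax_r|exact Hf].
Qed.

(** The functions that compute the integral over the larger segment are
    nonnegative, so their integrals decrease upon restriction, and on the smaller
    segment they still agree with [f] off thin sets. *)
Lemma is_bounded_integral_segment_le (f : pfun) (h k h' k' v w M : R) :
  h' <= h -> h <= k -> k <= k' -> 0 <= M ->
  is_bounded_integral f h k v -> is_bounded_integral f h' k' w ->
  (forall x, 0 <= f x <= M) -> v <= w.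
Proof.
  intros Hh Hhk Hk HM Hv (_ & _ & phi & Happ & Hlim) HfM.
  apply (is_lim_seq_le (fun _ => v) (fun n => RInt (phi n) h' k' + 2 * M * / INR (n + 1)) v w);
    [|apply is_lim_seq_const|apply is_lim_seq_add_inv_INR, Hlim].
  intros n.
  assert (Hb := approximating_between f h' k' 0 M phi Happ (fun x _ _ => HfM x) n).
  destruct (approximating_equal f h' k' phi n Happ) as (B & HB & Heq).
  set (psi := fun x => phi n (clamp h' k' x)).
  assert (Hpsi : forall x, continuous psi x).
  { apply continuous_clamp; [lra|]. now apply approximating_continuous with f. }
  assert (Hpsi0 : forall x, 0 <= psi x <= M).
  { intros x. apply Hb, clamp_in. lra. }
  assert (H1 : v <= RInt psi h k + 0 * (k - h) + 2 * M * / INR (n + 1)).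
  { apply is_bounded_integral_le_RInt with f B; try assumption; try lra.
    - intros x _ _. now apply Rabs_le_between; specialize (HfM x); lra.
    - intros x _. apply Rabs_le_between. specialize (Hpsi0 x). lra.
    - intros x Hx HBx _. assert (Hx' : segment h' k' x) by (destruct Hx; split; lra).
      unfold psi. rewrite clamp_id by exact Hx'.
      rewrite (proj2 (Heq x Hx' HBx)). lra. }
  assert (H2 : RInt psi h' k' = RInt (phi n) h' k') by (apply RInt_clamp; lra).
  rewrite (RInt_split psi h' h k' Hpsi), (RInt_split psi h k k' Hpsi) in H2.
  assert (H3 := RInt_const_le psi h' h 0 Hpsi Hh (fun x _ => proj1 (Hpsi0 x))).
  assert (H4 := RInt_const_le psi k k' 0 Hpsi Hk (fun x _ => proj1 (Hpsi0 x))).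
  lra.
Qed.

Lemma truncated_integral_monotone (f : pfun) (rho rho' N N' : R) :
  quasicontinuous_on line f -> 0 < rho <= rho' -> 0 <= N <= N' ->
  truncated_integral f rho N <= truncated_integral f rho' N'.
Proof.
  intros Hf Hrho HN.
  apply Rle_trans with (truncated_integral f rho' N).
  - apply is_bounded_integral_segment_le with (truncation f N) (- rho) rho (- rho') rho' N;
      try lra; try (apply truncated_integral_correct; [exact Hf|lra|lra]).
    intros x. apply truncation_between. lra.
  - assert (H := is_bounded_integral_le (truncation f N) (truncation f N') (- rho') rho'
      (truncated_integral f rho' N) (truncated_integral f rho' N') N' 0 0 (fun _ => False)).
    specialize (H ltac:(lra) ltac:(lra) ltac:(lra)
      (truncated_integral_correct f rho' N Hf ltac:(lra) ltac:(lra))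
      (truncated_integral_correct f rho' N' Hf ltac:(lra) ltac:(lra))
      (truncation_dominated f _ _ N N' ltac:(lra) ltac:(lra))
      (truncation_dominated f _ _ N' N' ltac:(lra) ltac:(lra))
      (thin_empty _ (fun _ F => F))).
    apply Rle_trans with (1 := H ltac:(intros x _ _ _ _; simpl; unfold Rmin;
      repeat destruct (Rle_dec _ _); lra)). lra.
Qed.

(** [lim2] is obtained with the choice operator; along the diagonal it is the
    limit of a sequence, which makes it unique. *)
Lemma lim2_unique (F : R -> R -> R) (l : Rbar) : is_lim2 F l -> lim2 F = l.
Proof.
  assert (Hdiag : forall l', is_lim2 F l' -> is_lim_seq (fun n => F (INR n) (INR n)) l').
  { intros l' Hl'.
    apply (filterlim_comp _ _ _ (fun n => (INR n, INR n))
      (fun p => F (fst p) (snd p)) _ _ _ (filterlim_pair _ _ is_lim_seq_INR is_lim_seq_INR) Hl'). }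
  intros Hl.
  assert (Hlim := epsilon_spec (inhabits (Finite 0)) (is_lim2 F) (ex_intro _ l Hl)).
  fold (lim2 F) in Hlim.
  rewrite <- (is_lim_seq_unique _ _ (Hdiag _ Hlim)). apply is_lim_seq_unique, Hdiag, Hl.
Qed.

(** Unlike the limit of the definition, a supremum is attained up to a small error
    at a single pair [rho, N], where the convergence of the integrals can be
    used. *)
Definition is_sup2 (F : R -> R -> R) (l : Rbar) : Prop :=
  (forall rho N, 0 < rho -> 0 < N -> Rbar_le (F rho N) l) /\
  (forall a : R, Rbar_lt a l -> exists rho N, 0 < rho /\ 0 < N /\ a < F rho N).

Definition increasing2 (F : R -> R -> R) : Prop :=
  forall rho rho' N N', 0 < rho <= rho' -> 0 < N <= N' -> F rho N <= F rho' N'.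

Lemma is_sup2_exists (F : R -> R -> R) : exists l, is_sup2 F l.
Proof.
  set (E := fun y => exists rho N, 0 < rho /\ 0 < N /\ y = F rho N).
  destruct (Lub_Rbar_correct E) as [Hub Hlub]. exists (Lub_Rbar E). split.
  - intros rho N Hrho HN. apply Hub. now exists rho, N.
  - intros a Ha. apply NNPP. intros Hno. apply (Rbar_lt_not_le _ _ Ha).
    apply Hlub. intros y (rho & N & Hrho & HN & ->). apply Rnot_lt_le. intros Hlt.
    apply Hno. now exists rho, N.
Qed.

Lemma is_sup2_lim2 (F : R -> R -> R) (l : Rbar) :
  increasing2 F -> is_sup2 F l -> is_lim2 F l.
Proof.
  intros HF [Hub Hsup] P HP.
  assert (H : exists a : R, Rbar_lt a l /\ forall y : R, a < y -> Rbar_le y l -> P y).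
  { destruct l as [l| |].
    - destruct HP as [eps HP]. exists (l - eps). split.
      + simpl. assert (H := cond_pos eps). lra.
      + intros y Hy Hyl. simpl in Hyl. apply HP.
        assert (H := cond_pos eps).
        apply Rabs_def1; unfold minus, plus, opp; simpl; lra.
    - destruct HP as [M HP]. exists M. split; [exact I|]. intros y Hy _. now apply HP.
    - elim (Hub 1 1); lra. }
  destruct H as (a & Ha & HaP).
  destruct (Hsup a Ha) as (rho0 & N0 & Hrho0 & HN0 & HFa).
  exists (fun rho => rho0 < rho) (fun N => N0 < N).
  - now exists rho0.
  - now exists N0.
  - intros rho N Hrho HN. simpl. apply HaP.
    + apply Rlt_le_trans with (1 := HFa). apply HF; lra.
    + apply Hub; lra.
Qed.

Lemma integral_pos_is_sup2 (f : pfun) :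
  quasicontinuous_on line f -> is_sup2 (truncated_integral f) (integral_pos f).
Proof.
  intros Hf. destruct (is_sup2_exists (truncated_integral f)) as [l Hl].
  replace (integral_pos f) with l; [exact Hl|].
  symmetry. apply (lim2_unique (truncated_integral f)). apply is_sup2_lim2; [|exact Hl].
  intros rho rho' N N' Hrho HN. apply truncated_integral_monotone; [exact Hf|lra|lra].
Qed.

Lemma is_bounded_integral_zero (f : pfun) (h k v : R) :
  h <= k -> (forall x, f x = 0) -> is_bounded_integral f h k v -> v = 0.
Proof.
  intros Hhk Hf (_ & _ & phi & Happ & Hlim).
  assert (H : forall n, RInt (phi n) h k = 0).
  { intros n. transitivity (RInt (fun _ => 0) h k).
    - apply RInt_ext. intros x Hx. rewrite Rmin_left, Rmax_right in Hx by lra.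
      destruct (approximating_between f h k 0 0 phi Happ) with (n := n) (x := x).
      + intros y _ _. rewrite Hf. lra.
      + split; lra.
      + apply Rle_antisym; assumption.
    - rewrite RInt_constant. apply Rmult_0_l. }
  assert (H0 := is_lim_seq_unique _ _ (is_lim_seq_ext _ _ _ H Hlim)).
  rewrite Lim_seq_const in H0. now injection H0.
Qed.

(** Comparison with the zero function in both directions. *)
Lemma is_bounded_integral_ae_zero (f : pfun) (h k v : R) :
  h < k -> ae (fun x => dom f x -> f x = 0) -> is_bounded_integral f h k v -> v = 0.
Proof.
  intros Hhk Hf Hv. set (z := pmap (fun _ => 0) f).
  destruct (is_bounded_integral_exists z h k Hhk) as [w Hw].
  { exists 0. intros x _ _. simpl. rewrite Rabs_R0. lra. }
  { apply quasicontinuous_pmap; [intros y; apply continuous_const|apply Hv]. }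
  assert (Hw0 : w = 0).
  { apply is_bounded_integral_zero with z h k; [lra|reflexivity|exact Hw]. }
  destruct (is_bounded_integral_dominated f h k v Hv) as (M & HM & HfM).
  assert (HzM : dominated z h k M) by (intros x _ _; simpl; rewrite Rabs_R0; exact HM).
  assert (Hae : forall t, 0 < t -> thin t (fun x => ~ (dom f x -> f x = 0)))
    by (intros t Ht; now apply null_set_thin).
  assert (H1 : v <= w).
  { apply le_of_le_add_mult with (2 * M); [lra|]. intros t Ht.
    apply Rle_trans with (w + 0 * (k - h) + 2 * M * t); [|lra].
    apply is_bounded_integral_le with (A := fun x => ~ (dom f x -> f x = 0)) (f := f) (g := z);
      try assumption; try lra; [now apply Hae|].
    intros x _ HA Hdx _. simpl. rewrite (NNPP _ HA Hdx). lra. }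
  assert (H2 : w <= v).
  { apply le_of_le_add_mult with (2 * M); [lra|]. intros t Ht.
    apply Rle_trans with (v + 0 * (k - h) + 2 * M * t); [|lra].
    apply is_bounded_integral_le with (A := fun x => ~ (dom f x -> f x = 0)) (f := z) (g := f);
      try assumption; try lra; [now apply Hae|].
    intros x _ HA _ Hdx. simpl. rewrite (NNPP _ HA Hdx). lra. }
  lra.
Qed.

Lemma integral_neg_ae_nonneg (f : pfun) :
  quasicontinuous_on line f -> ae (fun x => 0 <= f x) -> integral_neg f = 0.
Proof.
  intros Hf Hae.
  set (F := fun rho K => bounded_integral (pmap (fun y => Rmax y (- K)) (neg_part f)) (- rho) rho).
  assert (HF : forall rho K, 0 < rho -> 0 < K -> F rho K = 0).
  { intros rho K Hrho HK.
    apply is_bounded_integral_ae_zero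
      with (pmap (fun y => Rmax y (- K)) (neg_part f)) (- rho) rho; [lra| |].
    - intros eps. destruct (Hae eps) as (D & HD & Hc). exists D. split; [exact HD|].
      intros x Hx. apply Hc. intros H0. apply Hx. intros _. simpl.
      rewrite Rmin_right, Rmax_left; lra.
    - apply bounded_integral_correct; [lra| |].
      + exists K. intros x _ _. simpl. apply Rabs_le_between.
        unfold Rmax, Rmin. repeat destruct (Rle_dec _ _); lra.
      + apply quasicontinuous_segment.
        apply quasicontinuous_pmap; [apply continuous_Rmax_r|].
        apply quasicontinuous_pmap; [apply continuous_Rmin_r|exact Hf]. }
  apply (lim2_unique F), is_sup2_lim2.
  - intros rho rho' K K' Hrho HK. rewrite !HF; lra.
  - split.
    + intros rho K Hrho HK. rewrite HF by assumption. apply Rle_refl.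
    + intros a Ha. exists 1, 1. rewrite HF by lra. simpl in Ha. lra.
Qed.

Lemma integral_ae_nonneg (f : pfun) :
  quasicontinuous_on line f -> ae (fun x => 0 <= f x) ->
  integrable f /\ integral f = integral_pos f.
Proof.
  intros Hf Hae. assert (H := integral_neg_ae_nonneg f Hf Hae). split.
  - split; [exact Hf|]. right. rewrite H. reflexivity.
  - unfold integral. rewrite H. apply Rbar_plus_0_r.
Qed.

(** * Monotone convergence *)

Lemma ae_mono (P Q : R -> Prop) : ae P -> (forall x, P x -> Q x) -> ae Q.
Proof.
  intros HP HPQ eps. destruct (HP eps) as (D & HD & Hc). exists D. split; [exact HD|].
  intros x Hx. apply Hc. intros HPx. apply Hx, HPQ, HPx.
Qed.

Lemma truncated_integral_le (f g : pfun) (rho N : R) :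
  quasicontinuous_on line f -> quasicontinuous_on line g ->
  ae (fun x => f x <= g x) -> 0 < rho -> 0 < N ->
  truncated_integral f rho N <= truncated_integral g rho N.
Proof.
  intros Hf Hg Hae Hrho HN.
  apply le_of_le_add_mult with (2 * N); [lra|]. intros t Ht.
  apply Rle_trans with
    (truncated_integral g rho N + 0 * (rho - - rho) + 2 * N * t); [|lra].
  apply is_bounded_integral_le
    with (f := truncation f N) (g := truncation g N) (A := fun x => ~ f x <= g x); try lra;
    try (apply truncated_integral_correct; [assumption|lra|lra]);
    try (apply truncation_dominated; lra).
  - now apply null_set_thin.
  - intros x _ HA _ _. apply NNPP in HA. simpl.
    unfold Rmin, Rmax. repeat destruct (Rle_dec _ _); lra.
Qed.

Lemma truncated_integral_limit (fn : nat -> pfun) (f : pfun) (rho N t : R) :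
  (forall n, quasicontinuous_on line (fn n)) -> quasicontinuous_on line f ->
  ae (increases_to fn f) -> 0 < rho -> 0 < N -> 0 < t ->
  exists n, forall m, (n <= m)%nat ->
    truncated_integral f rho N <= truncated_integral (fn m) rho N + t.
Proof.
  intros Hfn Hf Hae Hrho HN Ht.
  destruct (almost_uniform_convergence fn f (fun y => Rmin (Rmax y 0) N) N (- rho) rho
    (t / (4 * rho)) (t / (4 * N)) Hfn Hae) as (n & A & HA & H).
  - lra.
  - apply Rdiv_lt_0_compat; lra.
  - apply Rdiv_lt_0_compat; lra.
  - intros y. apply (continuous_comp (fun y => Rmax y 0) (fun y => Rmin y N));
      [apply continuous_Rmax_r|apply continuous_Rmin_r].
  - intros y z Hyz. unfold Rmin, Rmax. repeat destruct (Rle_dec _ _); lra.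
  - intros y. apply Rabs_le_between. unfold Rmin, Rmax. repeat destruct (Rle_dec _ _); lra.
  - exists n. intros m Hm.
    replace t with (t / (4 * rho) * (rho - - rho) + 2 * N * (t / (4 * N)))
      by (field; lra).
    rewrite <- Rplus_assoc.
    apply is_bounded_integral_le with (f := truncation f N) (g := truncation (fn m) N) (A := A);
      try lra; try assumption;
      try (apply truncated_integral_correct; [auto|lra|lra]);
      try (apply truncation_dominated; lra).
    + left. apply Rdiv_lt_0_compat; lra.
    + intros x Hx HAx _ _. now apply (H x Hx HAx).
Qed.

Theorem theorem62 (fn : nat -> pfun) (f : pfun)
    (hint : forall n : nat, integrable (fn n))
    (hae : ae (fun x : R =>
       (forall n : nat, dom (fn n) x) /\ dom f x /\
       (forall n : nat, 0 <= fn n x <= fn (S n) x) /\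
       is_lim_seq (fun n : nat => fn n x) (f x))) :
  integrable f /\
  is_lim_seq_Rbar (fun n : nat => integral (fn n)) (integral f).
Proof.
  assert (Hae : ae (increases_to fn f)) by exact hae.
  assert (Hfn : forall n, quasicontinuous_on line (fn n)) by (intros n; apply hint).
  assert (Hf := limit_quasicontinuous fn f Hfn Hae).
  assert (Hfn0 : forall n, ae (fun x => 0 <= fn n x)).
  { intros n. apply ae_mono with (1 := Hae). intros x Hx. apply Hx. }
  assert (Hfnf : forall n, ae (fun x => fn n x <= f x)).
  { intros n. apply ae_mono with (1 := Hae). intros x. apply increases_to_le_limit. }
  assert (Hf0 : ae (fun x => 0 <= f x)).
  { apply ae_mono with (1 := Hae). intros x Hx.
    apply Rle_trans with (fn 0%nat x); [apply Hx|now apply increases_to_le_limit]. }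
  destruct (integral_ae_nonneg f Hf Hf0) as [Hint Heq].
  assert (Heqn : forall n, integral (fn n) = integral_pos (fn n))
    by (intros n; now apply integral_ae_nonneg).
  destruct (integral_pos_is_sup2 f Hf) as [Hub Hsup].
  split; [exact Hint|]. rewrite Heq. split.
  - (* below: a single pair [rho, N] already gives a value above [a] *)
    intros a Ha. destruct (Hsup a Ha) as (rho & N & Hrho & HN & HaF).
    destruct (truncated_integral_limit fn f rho N ((truncated_integral f rho N - a) / 2)
      Hfn Hf Hae Hrho HN) as [n Hn]; [lra|].
    exists n. intros m Hm. rewrite Heqn. specialize (Hn m Hm).
    apply Rbar_lt_le_trans with (truncated_integral (fn m) rho N); [simpl; lra|].
    now apply integral_pos_is_sup2.
  - (* above: every integral of the sequence is at most the integral of [f] *)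
    intros b Hb. exists 0%nat. intros n _. rewrite Heqn.
    apply Rbar_le_lt_trans with (2 := Hb).
    apply Rbar_not_lt_le. intros Hlt.
    destruct (integral_pos_is_sup2 (fn n) (Hfn n)) as [Hubn Hsupn].
    assert (H1 : Rbar_le (truncated_integral f 1 1) (integral_pos f)) by (apply Hub; lra).
    destruct (integral_pos f) as [l| |].
    + destruct (Hsupn l Hlt) as (rho & N & Hrho & HN & HlF).
      assert (H2 : Rbar_le (truncated_integral f rho N) l) by now apply Hub.
      assert (H3 := truncated_integral_le (fn n) f rho N (Hfn n) Hf (Hfnf n) Hrho HN).
      simpl in H2. lra.
    + exact Hlt.
    + exact H1.
Qed.
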